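(* Let $G$ be a finite solvable group and assume that $\mathrm{Pow}(G)$ is a cograph. If $\pi(G)$ is disconnected, then one of the following holds (for suitable, pairwise distinct primes named by different letters): (1) $\pi(G)$ is the empty (edgeless) graph on two vertices. Here $\mathrm{Fit}(G)$ is a $p$-group for a prime $p$, and $G/\mathrm{Fit}(G)$ is a generalized quaternion $2$-group or (isomorphic to) a subgroup of a semidirect product $C_{q^k}\rtimes C_{p^m}$ for a prime $q\ne p$ and integers $k,m\ge 0$, where if $m>0$ then $C_{p^m}$ acts fixed-point-freely on $C_{q^k}$. In any case, $\mathrm{Fit}_2(G)/\mathrm{Fit}(G)$ acts fixed-point-freely on $\mathrm{Fit}(G)$. (2) $\pi(G)$ consists of an edge $\{p,q\}$ together with a third, isolated vertex $r$. Then $G$ is in one of two cases: (a) $G\cong C_{pq}\rtimes C_{r^n}$ with $n\ge 1$, and $C_{r^n}$ acts fixed-point-freely on $C_{pq}$ (in particular, $r^n$ divides $q-1$ and $p-1$). (b) $\mathrm{Fit}(G)$ is an $r$-group and $\mathrm{Fit}_2(G)/\mathrm{Fit}(G)\cong C_{pq}$ acts fixed-point-freely on $\mathrm{Fit}(G)$. Moreover, $G/\mathrm{Fit}_2(G)$ is either trivial or isomorphic to $C_{r^n}$ for some $n\ge1$, acting as a fixed-point-free subgroup of $\mathrm{Aut}(C_{pq})$ on $\mathrm{Fit}_2(G)/\mathrm{Fit}(G)\cong C_{pq}$. (3) $\pi(G)$ consists of two disjoint edges $\{p,q\}$ and $\{r,s\}$, where $pq$ divides $r-1$ and $s-1$.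 Then $G$ is of the form $C_{rs}\rtimes C_{pq}$ with $C_{pq}$ acting fixed-point-freely on $C_{rs}$. Conversely, all groups described in (1)–(3) are power-cograph groups.
   Context: The power graph $\mathrm{Pow}(G)$ of a group $G$ is the undirected graph with vertex set $G$ in which two distinct elements $g,h$ are joined by an edge iff $g^n=h$ or $h^n=g$ for some $n\in\mathbb{N}$. A cograph is a graph with no induced path on four vertices. A power-cograph group is a group whose power graph is a cograph. The prime graph $\pi(G)$ of a finite group $G$ has as vertices the primes dividing $|G|$; two distinct primes $p,q$ are adjacent iff $G$ contains an element of order $pq$. $C_n$ denotes the cyclic group of order $n$. $\mathrm{Fit}(G)$ is the largest normal nilpotent subgroup of $G$, and $\mathrm{Fit}_2(G)$ is the subgroup of $G$ with $\mathrm{Fit}_2(G)/\mathrm{Fit}(G)=\mathrm{Fit}(G/\mathrm{Fit}(G))$. A group acts fixed-point-freely on a group $K$ if every non-trivial element of it fixes only the identity of $K$. For $N\trianglelefteq G$ and $N\le L\le G$, $L/N$ acts fixed-point-freely on $N$ if, for every $g\in L\setminus N$, conjugation by $g$ fixes only the identity of $N$. *)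

(* Defs.v *)
From mathcomp Require Import all_boot all_fingroup all_solvable.

Set Implicit Arguments.
Unset Strict Implicit.
Unset Printing Implicit Defensive.

Local Open Scope group_scope.

(* An undirected graph is a vertex set V in an ambient type together with a
   symmetric irreflexive adjacency relation e; only its restriction to V
   matters. *)
Definition induced_P4 (T : eqType) (e : T -> T -> Prop) (a b c d : T) : Prop :=
  [/\ uniq [:: a; b; c; d],
      [/\ e a b, e b c & e c d]
    & [/\ ~ e a c, ~ e a d & ~ e b d]].

Definition cograph (T : finType) (V : {set T}) (e : T -> T -> Prop) : Prop :=
  forall a b c d : T,
    a \in V -> b \in V -> c \in V -> d \in V -> ~ induced_P4 e a b c d.

Definition power_adj (gT : finGroupType) (g h : gT) : Prop :=
  g <> h /\ exists n : nat, g ^+ n = h \/ h ^+ n = g.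

Definition power_cograph (gT : finGroupType) (G : {group gT}) : Prop :=
  cograph G (@power_adj gT).

(* The vertices of the prime graph are the elements of [primes #|G|]. *)
Definition prime_adj (gT : finGroupType) (G : {group gT}) (p q : nat) : bool :=
  (p != q) && [exists x in G, #[x] == (p * q)%N].

Definition prime_graph_rel (gT : finGroupType) (G : {group gT}) :
    rel (seq_sub (primes #|G|)) :=
  fun p q => prime_adj G (val p) (val q).
Arguments prime_graph_rel {gT} G _ _.

Definition prime_graph_disconnected
    (gT : finGroupType) (G : {group gT}) : Prop :=
  exists p q : seq_sub (primes #|G|), ~~ connect (prime_graph_rel G) p q.

(* The vertices of the prime graph of G are exactly the members of V, and its
   edges are exactly the unordered pairs listed in E. As [primes #|G|] is a
   duplicate-free list of primes, [perm_eq] makes the members of V pairwise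
   distinct primes. *)
Definition prime_graph_is (gT : finGroupType) (G : {group gT})
    (V : seq nat) (E : seq (nat * nat)) : Prop :=
  perm_eq (primes #|G|) V /\
  {in V &, forall a b,
     prime_adj G a b = ((a, b) \in E) || ((b, a) \in E)}.

Definition cyclic_of_order (gT : finGroupType) (n : nat) (A : {set gT}) : Prop :=
  cyclic A /\ #|A| = n.

Definition Fitting2 (gT : finGroupType) (G : {group gT}) : {group gT} :=
  (coset 'F(G) @*^-1 'F(G / 'F(G)))%G.

(* L / N acts fixed-point-freely on N, for N normal in L. This differs from
   [semiregular N L], where N itself would have to act fixed-point-freely. *)
Definition quo_acts_fpf (gT : finGroupType) (L N : {set gT}) : Prop :=
  {in L :\: N, forall g, 'C_N[g] = 1}.

(* G = K ><| H with K, H cyclic of orders a, b. The condition [semiregular K H]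
   says that every non-trivial element of H fixes only the identity of K. *)
Definition cyclic_sdprod_fpf (gT : finGroupType) (G : {group gT}) (a b : nat) :
    Prop :=
  exists K H : {group gT},
    [/\ K ><| H = G, cyclic_of_order a K, cyclic_of_order b H
      & semiregular K H].

Definition generalized_quaternion (gT : finGroupType) (A : {set gT}) : Prop :=
  exists2 n : nat, (2 < n)%N & A \isog 'Q_(2 ^ n)%N.

Definition embeds_in_cyclic_sdprod
    (gT : finGroupType) (p : nat) (A : {set gT}) : Prop :=
  exists (q k m : nat) (hT : finGroupType) (S K H B : {group hT}),
    [/\ prime q /\ q <> p,
        [/\ K ><| H = S, cyclic_of_order (q ^ k)%N K & cyclic_of_order (p ^ m)%N H],
        (0 < m)%N -> semiregular K H,
        B \subset S
      & A \isog B].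

Definition case_1 (gT : finGroupType) (G : {group gT}) : Prop :=
  (exists a b : nat, prime_graph_is G [:: a; b] [::]) /\
  exists p : nat,
    [/\ prime p,
        p.-group 'F(G),
        generalized_quaternion (G / 'F(G))
          \/ embeds_in_cyclic_sdprod p (G / 'F(G))
      & quo_acts_fpf (Fitting2 G) 'F(G)].

Definition case_2a (gT : finGroupType) (G : {group gT}) (p q r : nat) : Prop :=
  exists n : nat,
    [/\ (0 < n)%N,
        cyclic_sdprod_fpf G (p * q)%N (r ^ n)%N,
        (r ^ n %| q - 1)%N
      & (r ^ n %| p - 1)%N].

(* G / Fitting2 G acts on Fitting2 G / 'F(G) by conjugation inside G / 'F(G).
   As Fitting2 G / 'F(G) is non-trivial, the fixed-point-freeness of this
   action implies that it is faithful. *)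
Definition case_2b (gT : finGroupType) (G : {group gT}) (p q r : nat) : Prop :=
  [/\ r.-group 'F(G),
      cyclic_of_order (p * q)%N (Fitting2 G / 'F(G)),
      quo_acts_fpf (Fitting2 G) 'F(G)
    & G / Fitting2 G = 1
      \/ (exists2 n : nat, (0 < n)%N & cyclic_of_order (r ^ n)%N (G / Fitting2 G))
         /\ quo_acts_fpf (G / 'F(G)) (Fitting2 G / 'F(G))].

Definition case_2 (gT : finGroupType) (G : {group gT}) : Prop :=
  exists p q r : nat,
    prime_graph_is G [:: p; q; r] [:: (p, q)]
    /\ (case_2a G p q r \/ case_2b G p q r).

Definition case_3 (gT : finGroupType) (G : {group gT}) : Prop :=
  exists p q r s : nat,
    [/\ prime_graph_is G [:: p; q; r; s] [:: (p, q); (r, s)],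
        (p * q %| r - 1)%N,
        (p * q %| s - 1)%N
      & cyclic_sdprod_fpf G (r * s)%N (p * q)%N].

(* Main.v *)
(* In a power-cograph group, any root a of an element x of prime order p that
   lies in a cyclic group <c> of order pq lies in <c>; conversely this property
   excludes induced paths. It forces the centralizer of such an x to be very
   small.

   Suppose G is solvable with disconnected prime graph, and F = Fit(G). If |F|
   has two prime divisors p, q, then F is cyclic of order pq and self-
   centralizing, G/F is abelian, and a prime r adjacent to neither p nor q
   prevents p and q from dividing |G/F|; so F has a complement, which acts
   fixed-point-freely and is therefore cyclic of order r^n or rs.

   If F is an r-group, then no r'-element commutes with an element of order r
   of V = Z(F), since it would centralize F. So the r'-elements act
   fixed-point-freely on V, and r'-subgroups behave like Frobenius complements:
   commuting elements of the same prime order generate the same subgroup and a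
   minimal normal subgroup <x> of a Hall r'-subgroup centralizes every element
   of another prime order. As the centralizer of x involves at most one further
   prime, at most three primes divide |G|, and Fit(G/F) is determined by its
   elements of prime order. *)

Require Import Defs.
From mathcomp Require Import all_boot all_fingroup all_solvable.
From mathcomp Require Import ssralg.

Set Implicit Arguments.
Unset Strict Implicit.
Unset Printing Implicit Defensive.

Local Open Scope group_scope.

(** * Power graphs *)

(** Equivalent to [power_cograph] by [power_cographP]. This form passes to subgroups and speaks only
    of roots of elements that lie on an edge of the prime graph, hence of centralizers. *)
Definition edge_root_closed (gT : finGroupType) (G : {group gT}) : Prop :=
  forall (p q : nat) (c x a : gT), prime p -> prime q -> p != q ->
    c \in G -> a \in G -> #[c] = (p * q)%N ->
    x \in <[c]> -> #[x] = p -> x \in <[a]> -> a \in <[c]>.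

Section PowerGraph.

Variables (gT : finGroupType) (G : {group gT}).
Implicit Types (p q r : nat) (a b c x y : gT).

Lemma power_adjE x y :
  power_adj x y <-> x != y /\ (y \in <[x]>) || (x \in <[y]>).
Proof.
split=> [[/eqP-> [n [<-|<-]]] | [/eqP neq_xy /orP[]/cycleP[n def]]].
- by rewrite mem_cycle.
- by rewrite mem_cycle orbT.
- by split=> //; exists n; left.
by split=> //; exists n; right.
Qed.

Lemma power_adjC x y : power_adj x y -> power_adj y x.
Proof. by move/power_adjE; rewrite eq_sym orbC => /power_adjE. Qed.

Lemma cycle_trans x y z : x \in <[y]> -> y \in <[z]> -> x \in <[z]>.
Proof. by rewrite -!cycle_subG; apply: subset_trans. Qed.

Lemma cycle_pelt_neq p q x y : prime p -> prime q -> p != q ->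
  #[x] = p -> #[y] = q -> x \notin <[y]>.
Proof.
move=> pr_p pr_q neq_pq ox oy; apply/negP=> /order_dvdG.
by rewrite -orderE ox oy dvdn_prime2 // (negPf neq_pq).
Qed.

Lemma commute_cycle p q x y : prime p -> prime q -> p != q ->
  #[x] = p -> #[y] = q -> commute x y ->
  [/\ #[x * y] = (p * q)%N, x \in <[x * y]> & y \in <[x * y]>].
Proof.
move=> pr_p pr_q neq_pq ox oy cxy.
have co: coprime #[x] #[y] by rewrite ox oy prime_coprime // dvdn_prime2.
split; first by rewrite orderM // ox oy.
  by rewrite (cycleM cxy co) (subsetP (mulG_subl _ _)) ?cycle_id.
by rewrite (cycleM cxy co) (subsetP (mulG_subr _ _)) ?cycle_id.
Qed.

Lemma cycle_prime_gen p c x y : prime p ->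
  #[x] = p -> #[y] = p -> x \in <[c]> -> y \in <[c]> -> <[x]> = <[y]>.
Proof.
move=> pr_p ox oy cx cy; apply/eqP.
by rewrite (eq_subG_cyclic (cycle_cyclic c)) ?cycle_subG // -!orderE ox oy.
Qed.

Lemma cycle_Cauchy p c : prime p -> p %| #[c] ->
  exists2 x, x \in <[c]> & #[x] = p.
Proof. by move=> pr_p p_c; have [x cx ox] := Cauchy pr_p p_c; exists x. Qed.

Lemma constt_mem_cycle (pi : nat_pred) x a :
  pi.-elt x -> x \in <[a]> -> x \in <[a.`_pi]>.
Proof.
move=> pi_x /cycleP[n def_x].
by rewrite -(constt_p_elt pi_x) def_x consttX mem_cycle.
Qed.

Lemma constt_notin (pi : nat_pred) y a : pi^'.-elt y -> y != 1 ->
  y \notin <[a.`_pi]>.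
Proof.
move=> pi'y nty; apply: contra nty => /cycleP[n def_y].
have: pi.-elt y by rewrite def_y p_eltX ?p_elt_constt.
by move=> pi_y; rewrite -order_eq1 (pnat_1 pi_y pi'y).
Qed.

Lemma prime_eltC p q x : prime p -> prime q -> p != q -> #[x] = p -> q^'.-elt x.
Proof.
move=> pr_p pr_q neq_pq ox; rewrite /p_elt ox p'natE //.
by rewrite dvdn_prime2 // eq_sym.
Qed.

Lemma prime_elt p x : prime p -> #[x] = p -> p.-elt x.
Proof. by move=> pr_p ox; rewrite /p_elt ox pnat_id. Qed.

Lemma prime_neq1 p x : prime p -> #[x] = p -> x != 1.
Proof. by move=> pr_p ox; rewrite -order_eq1 ox eqn_leq leqNgt prime_gt1. Qed.

(* The path is a -- x -- c -- y. *)
Lemma power_cograph_root p q c x y a :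
    power_cograph G -> prime p -> prime q -> p != q -> c \in G -> a \in G ->
    #[c] = (p * q)%N -> x \in <[c]> -> #[x] = p -> y \in <[c]> -> #[y] = q ->
  x \in <[a]> -> a \in <[x]> \/ y \in <[a]>.
Proof.
move=> PC pr_p pr_q neq_pq Gc Ga oc cx ox cy oy ax.
case: (boolP (a \in <[x]>)) => [|xa]; first by left.
case: (boolP (y \in <[a]>)) => [|ay]; first by right.
have xy: x \notin <[y]> by exact: (cycle_pelt_neq pr_p pr_q neq_pq ox oy).
have yx: y \notin <[x]> by apply: (cycle_pelt_neq pr_q pr_p _ oy ox); rewrite eq_sym.
have ca: c \notin <[a]>.
  by apply: contra ay; apply: cycle_trans.
have ac: a \notin <[c]>.
  apply: contra xa => ca'.
  have: #[a] %| p * q by rewrite -oc orderE order_dvdG.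
  have /dvdnP[k oa]: p %| #[a] by rewrite -ox order_dvdG.
  rewrite oa mulnC dvdn_pmul2l ?prime_gt0 // => k_q.
  case/primeP: (pr_q) => _ /(_ k k_q) /orP[]/eqP dk.
    by rewrite (cycle_prime_gen pr_p ox _ cx ca') ?cycle_id // oa dk mul1n.
  case/negP: ca; suff ->: <[a]> = <[c]> by rewrite cycle_id.
  by apply/eqP; rewrite eqEcard cycle_subG ca' -!orderE oc oa dk mulnC leqnn.
have [Gx Gy]: x \in G /\ y \in G.
  by split; [move: cx | move: cy]; apply: subsetP; rewrite cycle_subG.
have nax: a != x by apply: contraNneq xa => ->; apply: cycle_id.
have nac: a != c by apply: contraNneq ca => ->; apply: cycle_id.
have nay: a != y by apply: contraNneq ay => ->; apply: cycle_id.
have nxc: x != c by apply: contraNneq yx => ->.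
have nxy: x != y by apply: contraNneq xy => <-; apply: cycle_id.
have ncy: c != y by apply: contraNneq xy => <-.
case: (PC a x c y) => //; split.
- by rewrite /= !inE !negb_or nax nac nay nxc nxy ncy.
- by split; apply/power_adjE; rewrite ?ax ?cx ?cy ?orbT.
split=> /power_adjE[_ /orP[]]; apply/negP => //.
by apply: contra xy; apply: cycle_trans.
Qed.

(* Along an induced path a, b, c, d the power relation alternates, so up to
   reversal b lies in <a> and b, d in <c>; primes p, q at which the orders of b
   and d exceed each other yield a cyclic subgroup of order pq of <c>. *)
Lemma power_cographP : power_cograph G <-> edge_root_closed G.
Proof.
split=> [PC p q c x a pr_p pr_q neq_pq Gc Ga oc cx ox ax | EC].
  have [|y cy oy] := @cycle_Cauchy q c pr_q; first by rewrite oc dvdn_mull.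
  have neq_qp: q != p by rewrite eq_sym.
  have oc': #[c] = (q * p)%N by rewrite mulnC.
  have rootx := power_cograph_root PC pr_p pr_q neq_pq Gc _ oc cx ox cy oy.
  have rooty := power_cograph_root PC pr_q pr_p neq_qp Gc _ oc' cy oy cx ox.
  case: (rootx a) => // [/cycle_trans|ay]; first exact.
  have Gpi pi : a.`_pi \in G by apply: groupX.
  (* Here [y] is in [<[a]>] too. The [q]-part of [a] is a root of [y] but not of [x], hence lies in
     [<[y]>]; the [q']-part is a root of [x] but not of [y], hence lies in [<[x]>]. *)
  rewrite -(consttC q a) groupM //.
    case: (rooty a.`_q) => //.
    - by rewrite constt_mem_cycle ?(prime_elt pr_q).
    - by move/cycle_trans; apply.
    by rewrite (negPf (constt_notin _ (prime_eltC _ _ _ ox) _)) ?(prime_neq1 _ ox).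
  case: (rootx a.`_q^') => //.
  - by rewrite constt_mem_cycle ?(prime_eltC _ _ _ ox).
  - by move/cycle_trans; apply.
  rewrite (negPf (constt_notin _ _ (prime_neq1 _ oy))) //.
  by rewrite /p_elt pnatNK; apply: prime_elt.
have no_path b c d a : a \in G -> c \in G -> b \in <[a]> -> b \in <[c]> ->
    d \in <[c]> -> ~ power_adj b d -> b != d -> a != c -> ~ power_adj a c -> False.
  move=> Ga Gc ab cb cd nbd neq_bd neq_ac nac.
  have dvdN u v : u \in <[c]> -> v \in <[c]> -> u \notin <[v]> ->
      exists2 p, prime p & logn p #[v] < logn p #[u].
    move=> cu cv uv; case: (altP (@allP _ (fun p => logn p #[u] <= logn p #[v])
                                   (primes #[u]))) => [le_uv | ].
      case/negP: uv; have: #[u] %| #[v].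
        apply/dvdn_partP => // p u_p; have := u_p.
        rewrite -[p \in _]/(p \in primes _) mem_primes => /and3P[pr_p _ _].
        by rewrite p_part pfactor_dvdn // le_uv.
      by rewrite !orderE (cardSg_cyclic (cycle_cyclic c)) ?cycle_subG.
    case/allPn=> p; rewrite mem_primes -ltnNge => /and3P[pr_p _ _] lt.
    by exists p.
  have bd: b \notin <[d]>.
    by apply/negP=> bd; case: nbd; apply/power_adjE; rewrite bd orbT.
  have db: d \notin <[b]>.
    by apply/negP=> db; case: nbd; apply/power_adjE; rewrite db.
  have [p pr_p lt_p] := dvdN _ _ cb cd bd.
  have [q pr_q lt_q] := dvdN _ _ cd cb db.
  have neq_pq: p != q.
    by apply: contraTneq lt_p => ->; rewrite -leqNgt ltnW.
  have p_b: p %| #[b].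
    have := leq_ltn_trans (leq0n _) lt_p.
    by rewrite logn_gt0 mem_primes; case/and3P.
  have q_d: q %| #[d].
    have := leq_ltn_trans (leq0n _) lt_q.
    by rewrite logn_gt0 mem_primes; case/and3P.
  have [x bx ox] := cycle_Cauchy pr_p p_b.
  have [y dy oy] := cycle_Cauchy pr_q q_d.
  have cx := cycle_trans bx cb; have cy := cycle_trans dy cd.
  have cxy: commute x y by apply: (centsP (cycle_abelian c)).
  have [oxy xyx _] := commute_cycle pr_p pr_q neq_pq ox oy cxy.
  have cxy': x * y \in <[c]> by rewrite groupM.
  have Gxy: x * y \in G by apply: subsetP cxy'; rewrite cycle_subG.
  have := EC _ _ _ _ _ pr_p pr_q neq_pq Gxy Ga oxy xyx ox (cycle_trans bx ab).
  move/cycle_trans/(_ cxy') => ca; case: nac; apply/power_adjE.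
  by rewrite ca orbT.
move=> a b c d Ga Gb Gc Gd [].
rewrite /= !inE !negb_or !andbT => /and3P[/and3P[nab nac nad] /andP[nbc nbd] ncd].
case=> /power_adjE[_ ab] /power_adjE[_ bc] /power_adjE[_ cd] [Nac Nad Nbd].
have Ndb: ~ power_adj d b by move/power_adjC.
have Nca: ~ power_adj c a by move/power_adjC.
have up (u v w : gT) : u \in <[v]> -> v \in <[w]> -> u != w -> power_adj u w.
  move=> uv vw neq; apply/power_adjE; split=> //; apply/orP; right.
  exact: cycle_trans vw.
case/orP: ab => [ba | ab]; case/orP: bc => [cb | bc].
- by case: Nca; apply: up cb ba _; rewrite eq_sym.
- case/orP: cd => [dc | cd]; last by case: Nbd; apply: up bc cd _.
  exact: no_path ba bc dc Nbd nbd nac Nac.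
- case/orP: cd => [dc | cd]; first by case: Ndb; apply: up dc cb _; rewrite eq_sym.
  have ca: power_adj c a -> False by move/power_adjC.
  by apply: (no_path c b a d) => //; rewrite 1?eq_sym // => /power_adjC.
by case: Nac; apply: up ab bc _.
Qed.

End PowerGraph.

(** * Prime graphs *)

Section PrimeGraph.

Variables (gT : finGroupType) (G : {group gT}).
Implicit Types (p q r : nat) (a c x y z : gT).

Lemma prime_adjC p q : prime_adj G p q = prime_adj G q p.
Proof. by rewrite /prime_adj eq_sym mulnC. Qed.

Lemma prime_adj_dvd p q g : prime p -> prime q -> p != q ->
  g \in G -> p %| #[g] -> q %| #[g] -> prime_adj G p q.
Proof.
move=> pr_p pr_q neq_pq Gg p_g q_g; rewrite /prime_adj neq_pq.
have pq_g: p * q %| #[g].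
  by rewrite Gauss_dvd ?p_g // prime_coprime // dvdn_prime2.
apply/existsP; exists (g ^+ (#[g] %/ (p * q))); rewrite groupX //=.
by rewrite orderXdiv ?dvdn_div // divnA // mulKn.
Qed.

Lemma prime_adj_commute p q x y : prime p -> prime q -> p != q ->
  x \in G -> y \in G -> #[x] = p -> #[y] = q -> commute x y -> prime_adj G p q.
Proof.
move=> pr_p pr_q neq_pq Gx Gy ox oy cxy.
have [oxy _ _] := commute_cycle pr_p pr_q neq_pq ox oy cxy.
by rewrite /prime_adj neq_pq; apply/existsP; exists (x * y); rewrite groupM ?oxy /=.
Qed.

Lemma prime_adjP p q : prime p -> prime q -> prime_adj G p q ->
  exists x y, [/\ x \in G, y \in G, #[x] = p, #[y] = q & commute x y].
Proof.
move=> pr_p pr_q /andP[_ /existsP[c /andP[Gc /eqP oc]]].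
have sub z : z \in <[c]> -> z \in G by apply: subsetP; rewrite cycle_subG.
have [|x cx ox] := @cycle_Cauchy _ p c pr_p; first by rewrite oc dvdn_mulr.
have [|y cy oy] := @cycle_Cauchy _ q c pr_q; first by rewrite oc dvdn_mull.
exists x, y; rewrite !sub //; split=> //.
exact: (centsP (cycle_abelian c)).
Qed.

Lemma prime_adj_primes p q : prime p -> prime q -> prime_adj G p q ->
  (p \in primes #|G|) && (q \in primes #|G|).
Proof.
move=> pr_p pr_q /(prime_adjP pr_p pr_q)[x [y [Gx Gy ox oy _]]].
by rewrite !mem_primes pr_p pr_q cardG_gt0 -ox -oy !order_dvdG.
Qed.

Lemma prime_adj_quotient (N : {group gT}) p q : prime p -> prime q -> N <| G ->
  prime_adj (G / N) p q -> prime_adj G p q.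
Proof.
move=> pr_p pr_q nsNG /andP[neq_pq /existsP[c /andP[/morphimP[g Ng Gg ->] /eqP og]]].
have dvd_g: p * q %| #[g] by rewrite -og morph_order.
apply: (prime_adj_dvd pr_p pr_q neq_pq Gg).
  exact: dvdn_trans (dvdn_mulr _ _) dvd_g.
exact: dvdn_trans (dvdn_mull _ _) dvd_g.
Qed.

(** Without such an [r] every vertex would be joined to [p] or [q], hence any two would be
    connected. As [p = q] is allowed, this also yields a prime far from a single one. *)
Lemma disconnected_edge p q : prime_graph_disconnected G ->
    p \in primes #|G| -> q \in primes #|G| -> (p == q) || prime_adj G p q ->
  exists2 r, r \in primes #|G| &
    [/\ r != p, r != q, ~~ prime_adj G r p & ~~ prime_adj G r q].
Proof.
case=> a [b nab] Gp Gq adj_pq.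
pose far r := ~~ [|| r == p, r == q, prime_adj G r p | prime_adj G r q].
case: (boolP (has far (primes #|G|))) => [/hasP[r Gr] | /hasPn near].
  by rewrite /far !negb_or => /and4P[]; exists r.
pose sp := SeqSub Gp; pose sq := SeqSub Gq.
have csym: connect_sym (prime_graph_rel G).
  by apply: sym_connect_sym => u v; apply: prime_adjC.
have cpq: connect (prime_graph_rel G) sp sq.
  case/orP: adj_pq => [/eqP eq_pq | ]; last by move=> adj; apply: connect1.
  by rewrite (_ : sp = sq) ?connect0 //; apply: val_inj.
have to_p u : connect (prime_graph_rel G) u sp.
  have := near _ (valP u); rewrite negbK => /or4P[/eqP|/eqP||] def_u.
  - by rewrite (_ : u = sp) ?connect0 //; apply: val_inj.
  - by rewrite (_ : u = sq) 1?csym //; apply: val_inj.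
  - exact: (@connect1 _ (prime_graph_rel G) u sp def_u).
  rewrite csym in cpq; apply: connect_trans cpq.
  exact: (@connect1 _ (prime_graph_rel G) u sq def_u).
by case/negP: nab; apply: connect_trans (to_p a) _; rewrite csym.
Qed.

End PrimeGraph.

(** * Centralizers of prime-order elements on an edge *)

Section EdgeRootClosed.

Variables (gT : finGroupType) (G : {group gT}).
Hypothesis ecG : edge_root_closed G.
Implicit Types (p q r : nat) (a c x y z : gT).

Lemma edge_root_closedS (H : {group gT}) : H \subset G -> edge_root_closed H.
Proof.
move/subsetP=> sHG p q c x a pr_p pr_q neq_pq Hc Ha.
by apply: (ecG pr_p pr_q neq_pq); apply: sHG.
Qed.

Lemma edge_root p q x y a : prime p -> prime q -> p != q ->
    x \in G -> y \in G -> #[x] = p -> #[y] = q -> commute x y ->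
  a \in G -> x \in <[a]> -> a \in <[x * y]>.
Proof.
move=> pr_p pr_q neq_pq Gx Gy ox oy cxy Ga.
have [oxy xyx _] := commute_cycle pr_p pr_q neq_pq ox oy cxy.
exact: (ecG pr_p pr_q neq_pq (groupM Gx Gy) Ga oxy xyx ox).
Qed.

Lemma edge_root_pelt p q x y a : prime p -> prime q -> p != q ->
    x \in G -> y \in G -> #[x] = p -> #[y] = q -> commute x y ->
  a \in G -> p.-elt a -> x \in <[a]> -> a \in <[x]>.
Proof.
move=> pr_p pr_q neq_pq Gx Gy ox oy cxy Ga p_a ax.
have [oxy xyx _] := commute_cycle pr_p pr_q neq_pq ox oy cxy.
have := edge_root pr_p pr_q neq_pq Gx Gy ox oy cxy Ga ax => xya.
rewrite -cycle_subG -(cardSg_cyclic (cycle_cyclic (x * y))) ?cycle_subG //.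
rewrite -!orderE ox; have: #[a] %| p * q by rewrite -oxy order_dvdG.
rewrite Gauss_dvdl // (pnat_coprime p_a) // p'natE //.
by rewrite dvdn_prime2.
Qed.

(** As [x] and [z] have coprime orders, [x * z] is a root of [x]. So it lies in [<[x * y]>], and so
    does its power [z]. This bounds the [p']-elements of the centralizer of [x]. *)
Lemma edge_cent p q x y z : prime p -> prime q -> p != q ->
    x \in G -> y \in G -> #[x] = p -> #[y] = q -> commute x y ->
  z \in G -> commute x z -> p^'.-elt z -> z \in <[y]>.
Proof.
move=> pr_p pr_q neq_pq Gx Gy ox oy cxy Gz cxz p'z.
have [oxy xyx xyy] := commute_cycle pr_p pr_q neq_pq ox oy cxy.
have coxz: coprime #[x] #[z] by rewrite ox prime_coprime // -p'natE.
have cxM := cycleM cxz coxz.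
have xzx: x \in <[x * z]> by rewrite cxM (subsetP (mulG_subl _ _)) ?cycle_id.
have xzz: z \in <[x * z]> by rewrite cxM (subsetP (mulG_subr _ _)) ?cycle_id.
have xyxz := edge_root pr_p pr_q neq_pq Gx Gy ox oy cxy (groupM Gx Gz) xzx.
have xyz := cycle_trans xzz xyxz.
rewrite -cycle_subG -(cardSg_cyclic (cycle_cyclic (x * y))) ?cycle_subG //.
rewrite -!orderE oy; have: #[z] %| p * q by rewrite -oxy order_dvdG.
by rewrite Gauss_dvdr // coprime_sym prime_coprime // -p'natE.
Qed.

End EdgeRootClosed.

(* Then the centralizer of an element of order p has order pq. *)
Lemma edge_root_closed_isolated_edges (gT : finGroupType) (G : {group gT}) :
    (forall p q, prime p -> prime q -> prime_adj G p q ->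
       logn p #|G| = 1%N /\
       forall r, prime r -> prime_adj G p r -> r = q) ->
  edge_root_closed G.
Proof.
move=> isoG p q c x a pr_p pr_q neq_pq Gc Ga oc cx ox ax.
have adj_pq: prime_adj G p q.
  by rewrite /prime_adj neq_pq; apply/existsP; exists c; rewrite Gc oc /=.
have adj_qp: prime_adj G q p by rewrite prime_adjC.
have [lp onlyq] := isoG p q pr_p pr_q adj_pq.
have [lq _] := isoG q p pr_q pr_p adj_qp.
have sC b : b \in G -> x \in <[b]> -> b \in 'C_G[x].
  move=> Gb bx; rewrite inE Gb cent1C; apply/cent1P.
  by apply: (centsP (cycle_abelian b)); rewrite ?cycle_id.
have Gx: x \in G by move: cx; apply: subsetP; rewrite cycle_subG.
suff dvdC: #|'C_G[x]| %| p * q.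
  suff <-: 'C_G[x] = <[c]> by apply: sC.
  apply/esym/eqP; rewrite eqEcard cycle_subG sC //= -orderE oc.
  by rewrite dvdn_leq // muln_gt0 !prime_gt0.
apply/dvdn_partP => // r; rewrite -[r \in _]/(r \in primes _) mem_primes.
case/and3P=> pr_r _ r_C.
have [z /setIP[Gz /cent1P cxz] oz] := Cauchy pr_r r_C.
have lr: logn r #|G| = 1%N /\ r %| p * q.
  have [<-|neq_pr] := eqVneq p r; first by rewrite lp dvdn_mulr.
  rewrite (onlyq r) ?dvdn_mull //.
  by apply: (prime_adj_commute pr_p pr_r neq_pr Gx Gz).
case: lr => lr; apply: dvdn_trans.
rewrite p_part -[X in _ %| X]expn1 dvdn_exp2l // -lr.
by rewrite dvdn_leq_log // cardSg // subsetIl.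
Qed.

(** * Fixed-point-free actions on abelian groups *)

Section FixedPointFree.

Import GRing.Theory FiniteModule.

Variables (gT : finGroupType) (V : {group gT}).
Hypothesis abelV : abelian V.
Implicit Types (B H U : {group gT}).

(** The sum over [B] of the images of [v] is fixed by [B], as multiplication in [B] permutes the
    terms. *)
Lemma actr_sum_fpf B (v : fmod_of abelV) : B \subset 'N(V) -> 'C_V(B) = 1 ->
  (\sum_(b in B) v ^@ b = 0)%R.
Proof.
move=> nVB regB; set w := (\sum_(b in B) _)%R.
apply: val_inj; apply/set1gP; rewrite -regB inE fmodP /=; apply/centP=> b Bb.
have nVb := subsetP nVB b Bb.
apply/commgP/conjg_fixP; rewrite -fmvalJ //; congr (val _).
rewrite actr_sum (reindex_inj (mulIg b^-1)) /=.
apply: eq_big => [c | c Bc]; first by rewrite groupMr ?groupV.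
by rewrite -actrM ?mulgKV // (subsetP nVB).
Qed.

(* Sum v ^ f k i over all k in U and i in D, in both orders: for a fixed k the
   sum runs over the group B k, for a fixed i <> i0 it runs over a coset of U,
   and i = i0 contributes #|U| times v. *)
Lemma fpf_family_trivg (iT : finType) (D : {set iT}) (i0 : iT) U
    (f : gT -> iT -> gT) (B : gT -> {group gT}) :
    U \subset 'N(V) -> coprime #|V| #|U| -> 'C_V(U) = 1 -> i0 \in D ->
    (forall k, k \in U -> [/\ f k @: D = B k, {in D &, injective (f k)},
       B k \subset 'N(V), 'C_V(B k) = 1 & f k i0 = 1]) ->
    (forall i, i \in D -> i != i0 -> exists g, [/\ g \in 'N(V),
       {in U &, injective (f^~ i)} & f^~ i @: U = g *: U]) ->
  V :=: 1.
Proof.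
move=> nVU coVU regU Di0 famB famU; apply/trivgP/subsetP=> x Vx.
pose v := fmod abelV x.
have sum0: (\sum_(k in U) \sum_(i in D) v ^@ f k i = 0)%R.
  apply: big1 => k /famB[defB injB nVB regB _].
  by rewrite -[RHS](actr_sum_fpf v nVB regB) -defB big_imset.
suff vU: (v *+ #|U| = 0)%R.
  apply/set1gP/eqP; rewrite -order_eq1 -dvdn1 -(eqP coVU) dvdn_gcd order_dvdG //=.
  by rewrite order_dvdn -[x](fmodK abelV Vx) -fmvalZ vU.
rewrite -sum0 exchange_big (bigD1 i0) //= [X in (_ + X)%R]big1 ?addr0.
  rewrite (eq_bigr (fun=> v)) ?sumr_const // => k /famB[_ _ _ _ ->].
  by rewrite actr1.
move=> i /andP[Di ni0]; have [g [Ng injU defU]] := famU i Di ni0.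
rewrite -(big_imset (fun h => v ^@ h)%R injU) /= defU.
rewrite -lcosetE big_imset /=; last by move=> ? ? _ _; apply: mulgI.
rewrite -[RHS](actr_sum_fpf (v ^@ g)%R nVU regU).
by apply: eq_bigr => u Uu; rewrite actrM //; apply: (subsetP nVU).
Qed.

(** A Frobenius group with kernel [U] and complement [H] is covered by [U] and the conjugates
    [H :^ k]. The family is [h ^ k]: for [h != 1] the elements [h ^ k] with [k] in [U] are distinct
    and fill the coset of [U] at [h]. *)
Lemma fpf_sdprod_trivg U H :
    U \subset 'N(V) -> H \subset 'N(V) -> H \subset 'N(U) ->
    coprime #|V| #|U| -> 'C_V(U) = 1 -> 'C_V(H) = 1 -> semiregular U H ->
  V :=: 1.
Proof.
move=> nVU nVH nUH coVU regU regH regUH.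
apply: (@fpf_family_trivg _ H 1 U (fun k h => h ^ k) (fun k => (H :^ k)%G)) => //.
  move=> k Uk; have Nk := subsetP nVU k Uk; split=> //.
  - by move=> h1 h2 _ _; apply: conjg_inj.
  - by rewrite /= -(normP Nk) normJ conjSg.
  - by rewrite /= centJ -{1}(normP Nk) -conjIg regH conjs1g.
  by rewrite conj1g.
move=> h Hh nth; exists h; have Nh := subsetP nVH h Hh.
have injh: {in U &, injective (fun k => h ^ k)}.
  move=> k1 k2 Uk1 Uk2 /(congr1 (conjg^~ k2^-1)) /=; rewrite conjgK -conjgM.
  move/conjg_fixP/commgP=> chk; apply/eqP; rewrite eq_mulgV1.
  have: k1 * k2^-1 \in 'C_U[h].
    by rewrite inE groupM ?groupV //; apply/cent1P.
  by rewrite regUH ?inE ?nth.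
split=> //; apply/eqP; rewrite eqEcard card_lcoset card_in_imset // leqnn andbT.
apply/subsetP=> _ /imsetP[k Uk ->]; rewrite mem_lcoset conjgE !mulgA.
by rewrite groupM // -mulgA -conjgE memJ_norm ?groupV // (subsetP nUH).
Qed.

(** If [y] is outside [<[x]>], then [<[x]>] and the groups [<[y * k]>], for [k] in [<[x]>], are the
    [p + 1] subgroups of order [p] of an elementary abelian group of order [p ^ 2]. They serve as
    [U] and [B k], with [f k i = (y * k) ^+ i]. *)
Lemma fpf_commute_cycle p x y : prime p -> coprime #|V| p ->
    x \in 'N(V) -> y \in 'N(V) -> #[x] = p -> #[y] = p -> commute x y ->
    semiregular V <[x]> -> (forall k, k \in <[x]> -> 'C_V[y * k] = 1) ->
  y \in <[x]> \/ V :=: 1.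
Proof.
move=> pr_p coVp Nx Ny ox oy cxy regx regy.
case: (boolP (y \in <[x]>)) => xy; [by left | right].
pose f k (i : 'I_p) := (y * k) ^+ i.
have cyk k : k \in <[x]> -> commute y k.
  by case/cycleP=> n ->; apply: commuteX.
have oyk k : k \in <[x]> -> #[y * k] = p.
  move=> xk; apply: nt_prime_order => //.
    rewrite expgMn; last exact: cyk.
    rewrite -[in y ^+ _]oy expg_order mul1g; apply/eqP.
    by rewrite -order_dvdn -ox order_dvdG.
  by apply: contraNneq xy => yk1; rewrite -(mulgK k y) yk1 mul1g groupV.
apply: (@fpf_family_trivg _ setT (Ordinal (prime_gt0 pr_p)) <[x]>%G f
          (fun k => <[y * k]>%G)) => //.
- by rewrite cycle_subG.
- by rewrite -orderE ox.
- by rewrite cent_cycle regx // !inE cycle_id (prime_neq1 pr_p ox).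
- move=> k xk; have oyk' := oyk k xk; split=> //.
  + apply/setP=> z; apply/imsetP/idP=> [[i _ ->] | /cyclePmin[i]].
      exact: mem_cycle.
    by rewrite oyk' => lt_ip ->; exists (Ordinal lt_ip).
  + move=> i j _ _ /eqP; rewrite eq_expg_mod_order oyk' !modn_small //.
    by move/eqP; apply: val_inj.
  + by rewrite cycle_subG groupM // (subsetP _ k xk) ?cycle_subG.
  by rewrite cent_cycle regy.
move=> i _ nti; exists (y ^+ i).
have fM k: k \in <[x]> -> f k i = y ^+ i * k ^+ i.
  by move=> xk; rewrite /f expgMn //; apply: cyk.
have coxi: coprime #|<[x]>| i.
  rewrite -orderE ox prime_coprime // gtnNdvd //.
  by rewrite lt0n; apply: contra nti => /eqP i0; apply/eqP/val_inj.
have injf: {in <[x]> &, injective (f^~ i)}.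
  move=> k1 k2 xk1 xk2; rewrite !fM // => /mulgI.
  exact: (can_in_inj (expgK coxi)).
split=> //; first exact: groupX.
apply/eqP; rewrite eqEcard card_lcoset card_in_imset // leqnn andbT.
apply/subsetP=> _ /imsetP[k xk ->].
by rewrite fM // mem_lcoset mulKg groupX.
Qed.

End FixedPointFree.

(** * Solvable groups *)

(** Otherwise [C / Z] contains a non-trivial abelian [M / Z] normal in [G / Z]. As [M] centralizes
    ['F(G)], [Z] is central in [M], so [M] is nilpotent and normal, hence inside ['F(G)] and thus
    inside [Z]. *)
Lemma cent_sub_Fitting (gT : finGroupType) (G : {group gT}) :
  solvable G -> 'C_G('F(G)) \subset 'F(G).
Proof.
move=> solG; set C := 'C_G('F(G))%G; set Z := (C :&: 'F(G))%G.
have nsCG: C <| G.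
  by rewrite /normal subsetIl normsI ?normG // norms_cent // gFnorm.
have nsZG: Z <| G by rewrite normalI ?gFnormal.
have nsZC: Z <| C by apply: normalS nsZG; rewrite ?subsetIl.
suff: C / Z == 1.
  by rewrite -subG1 quotient_sub1 ?normal_norm // subsetI => /andP[].
apply: contraT => ntCZ.
have [Mb [sMbC nsMb ntMb /is_abelemP[p _ abelMb]]] :=
  solvable_norm_abelem (quotient_sol Z (solvableS (normal_sub nsCG) solG))
    (quotient_normal Z nsCG) ntCZ.
have [M defMb sZM nsMG] := inv_quotientN nsZG nsMb.
have sMC: M \subset C.
  rewrite -(quotientSGK _ (normal_sub nsZC)) -?defMb //.
  exact: subset_trans (normal_sub nsMG) (normal_norm nsZG).
have sZZ: Z \subset 'Z(M).
  rewrite subsetI sZM /=; apply: subset_trans (subsetIr _ _) _.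
  by rewrite centsC (subset_trans sMC) // subsetIr.
have nilM: nilpotent M.
  rewrite -quotient_center_nil abelian_nil // sub_der1_abelian //.
  apply: subset_trans sZZ; apply: der1_min; last first.
    by rewrite -defMb (abelem_abelian abelMb).
  exact: subset_trans (normal_sub nsMG) (normal_norm nsZG).
case/negP: ntMb; rewrite defMb -subG1 quotient_sub1; last first.
  exact: subset_trans (normal_sub nsMG) (normal_norm nsZG).
by rewrite subsetI sMC Fitting_max.
Qed.

Lemma p'nat_index_logn1 (gT : finGroupType) (G H : {group gT}) p : prime p ->
    H \subset G -> logn p #|G| = 1%N -> logn p #|H| = 1%N ->
  p^'.-nat #|G : H|.
Proof.
move=> pr_p sHG lG lH.
have := lognM p (cardG_gt0 H) (indexg_gt0 G H); rewrite Lagrange // lG lH.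
move=> /eqP; rewrite -{1}[1%N]addn0 eqn_add2l eq_sym => /eqP l0.
by rewrite p'natE // -[X in X %| _]expn1 pfactor_dvdn ?l0.
Qed.

Lemma quotient_cent_conj_aut (gT : finGroupType) (A X : {group gT}) :
  A \subset 'N(X) -> exists2 B : {group {perm gT}},
    B \subset Aut X & A / 'C_A(X) \isog B.
Proof.
move=> nXA; exists (conj_aut X @* A)%G; first exact: Aut_conj_aut.
have := first_isog_loc [morphism of conj_aut X] nXA.
by rewrite ker_conj_aut.
Qed.

Lemma quotient_cent_prime_cyclic (gT : finGroupType) (A X : {group gT}) :
  A \subset 'N(X) -> prime #|X| -> cyclic (A / 'C_A(X)).
Proof.
case/quotient_cent_conj_aut=> B sB isoB prX.
by rewrite (isog_cyclic isoB) (cyclicS sB) ?Aut_prime_cyclic.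
Qed.

Lemma der1_cent_cyclic (gT : finGroupType) (A X : {group gT}) :
  A \subset 'N(X) -> cyclic X -> A^`(1) \subset 'C_A(X).
Proof.
move=> nXA cycX; have [B sB isoB] := quotient_cent_conj_aut nXA.
apply: der1_min; first by rewrite normsI ?normG ?norms_cent.
by rewrite (isog_abelian isoB) (abelianS sB) ?Aut_cyclic_abelian.
Qed.

(** In a nilpotent group elements of coprime orders commute. So the [p]-part of any element
    centralizes [y] and its [p']-part centralizes [x], and [edge_cent] puts them in [<[x]>] and
    [<[y]>]. *)
Lemma nilpotent_edge_root_closed (gT : finGroupType) (K : {group gT}) p q :
    edge_root_closed K -> nilpotent K ->
    prime p -> prime q -> p != q -> p %| #|K| -> q %| #|K| ->
  exists x y, [/\ x \in K, y \in K, #[x] = p, #[y] = q & commute x y]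
    /\ K :=: <[x * y]>.
Proof.
move=> ecK nilK pr_p pr_q neq_pq p_K q_K.
have [x Kx ox] := Cauchy pr_p p_K; have [y Ky oy] := Cauchy pr_q q_K.
have ccop a b : a \in K -> b \in K -> coprime #[a] #[b] -> commute a b.
  move=> Ka Kb coab; have: <[a]> \subset 'C(<[b]>).
    by rewrite (sub_nilpotent_cent2 nilK) ?cycle_subG -?orderE 1?coprime_sym.
  by move/centsP; apply; apply: cycle_id.
have cxy: commute x y.
  by apply: ccop; rewrite // ox oy prime_coprime // dvdn_prime2.
exists x, y; split=> //; apply/eqP; rewrite eqEsubset andbC cycle_subG groupM //=.
have [oxy xyx xyy] := commute_cycle pr_p pr_q neq_pq ox oy cxy.
have neq_qp: q != p by rewrite eq_sym.
apply/subsetP=> a Ka; rewrite -(consttC p a) groupM //.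
  have Kap: a.`_p \in K by apply: groupX.
  apply: cycle_trans xyx; apply: (edge_cent ecK pr_q pr_p neq_qp Ky Kx oy ox _ Kap).
  - exact: commute_sym.
  - apply: ccop => //; rewrite coprime_sym (pnat_coprime (p_elt_constt p a)) //.
    exact: prime_eltC oy.
  apply: sub_in_pnat (p_elt_constt p a) => t _ /eqP->.
  by rewrite !inE.
apply: cycle_trans xyy.
apply: (edge_cent ecK pr_p pr_q neq_pq Kx Ky ox oy cxy (groupX _ Ka)).
  apply: ccop; rewrite ?groupX // (pnat_coprime (prime_elt pr_p ox)) //.
  exact: p_elt_constt.
exact: p_elt_constt.
Qed.

(* Modulo the cyclic group F all p-elements commute with all r-elements, so a
   larger Sylow p-subgroup would contain fixed points of an r-element. *)
Lemma logn_card_nonadj (gT : finGroupType) (G : {group gT}) p q r x y :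
    solvable G -> prime p -> prime q -> p != q ->
    x \in G -> y \in G -> #[x] = p -> #[y] = q -> commute x y ->
    G^`(1) \subset <[x * y]> ->
    prime r -> r %| #|G| -> r != p -> r != q -> ~~ prime_adj G r p ->
  logn p #|G| = 1%N.
Proof.
move=> solG pr_p pr_q neq_pq Gx Gy ox oy cxy sG'F pr_r r_G neq_rp neq_rq nadj.
have [oxy xyx xyy] := commute_cycle pr_p pr_q neq_pq ox oy cxy.
pose pi : nat_pred := [pred t | t \in [:: p; r]].
have sxG: <[x]> \subset G by rewrite cycle_subG.
have pi_x: pi.-group <[x]>.
  by rewrite /pgroup -orderE ox pnatE // !inE eqxx.
have [M hallM sxM] := Hall_superset solG sxG pi_x.
have sMG := pHall_sub hallM; have piM := pHall_pgroup hallM.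
(* The derived subgroup of [M] lies in a cyclic group of order [p * q], and only [p] and [r] can
   divide its order; so that order divides [p]. *)
have sM'x: M^`(1) \subset <[x]>.
  have sM'F := subset_trans (dergS 1 sMG) sG'F.
  rewrite -(cardSg_cyclic (cycle_cyclic (x * y))) ?cycle_subG //.
  rewrite -orderE ox; have: #|M^`(1)| %| p * q by rewrite -oxy cardSg.
  rewrite Gauss_dvdl // coprime_sym prime_coprime // -p'natE //.
  apply: sub_in_pnat (pgroupS (der_sub 1 M) piM) => t _; rewrite !inE.
  by case/orP=> /eqP->; rewrite // eq_sym.
have p_x: p.-group <[x]> by rewrite /pgroup -orderE ox pnat_id.
have [P sylP sxP] := Sylow_superset sxM p_x.
have sPM := pHall_sub sylP.
have [R sylR] := Sylow_exists r M; have sRM := pHall_sub sylR.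
have ntR: R :!=: 1.
  rewrite -cardG_gt1 (card_Hall sylR) p_part_gt1 mem_primes pr_r cardG_gt0 /=.
  rewrite (card_Hall hallM) -(part_pnat_id (_ : pi.-nat r)); last first.
    by rewrite pnatE // !inE eqxx orbT.
  by rewrite partn_dvd.
have nPM: M \subset 'N(P) by rewrite sub_der1_norm // (subset_trans sM'x).
have nxM: M \subset 'N(<[x]>) by rewrite sub_der1_norm.
have [w Rw ow]: exists2 w, w \in R & #[w] = r.
  have [_ r_R _] := pgroup_pdiv (pHall_pgroup sylR) ntR.
  by have [w Rw ow] := Cauchy pr_r r_R; exists w.
have Gw: w \in G by rewrite (subsetP sMG) ?(subsetP sRM).
have regP: 'C_P(R) = 1.
  apply/eqP; apply: contraT => ntC; have pC: p.-group 'C_P(R).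
    exact: pgroupS (subsetIl _ _) (pHall_pgroup sylP).
  have [_ p_C _] := pgroup_pdiv pC ntC.
  have [z /setIP[Pz cRz] oz] := Cauchy pr_p p_C.
  case/negP: nadj; apply: (prime_adj_commute pr_r pr_p neq_rp Gw _ ow oz).
    by rewrite (subsetP sMG) ?(subsetP sPM).
  exact/commute_sym/(centP cRz).
have coPR: coprime #|P| #|R|.
  rewrite (pnat_coprime (pHall_pgroup sylP)) //.
  apply: sub_in_pnat (pHall_pgroup sylR) => t _ /eqP->.
  by rewrite !inE.
have sPR: [~: P, R] \subset <[x]>.
  by apply: subset_trans sM'x; apply: commgSS.
(* Under a coprime action the fixed points of [R] on [P / <[x]>] come from those on [P], which are
   trivial; but [R] centralizes all of [P / <[x]>]. *)
have defP: P :=: <[x]>.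
  apply/eqP; rewrite eqEsubset sxP andbT -quotient_sub1 ?(subset_trans sPM) //.
  rewrite -(setIidPl (quotient_cents2r sPR)) /=.
  rewrite -coprime_quotient_cent ?(subset_trans sRM) ?regP ?quotient1 //.
  exact: pgroup_sol (pHall_pgroup sylP).
have sylPG: p.-Sylow(G) P.
  by apply: subHall_Sylow hallM _ sylP; rewrite !inE eqxx.
by rewrite -(logn_part p) -(card_Hall sylPG) defP -orderE ox logn_prime ?eqxx.
Qed.

(** * Recognition of the three shapes of prime graph *)

Lemma prime_graph_is_empty2 (gT : finGroupType) (G : {group gT}) p q :
    p != q -> primes #|G| =i [:: p; q] -> ~~ prime_adj G p q ->
  prime_graph_is G [:: p; q] [::].
Proof.
move=> neq_pq defV /negPf nadj; split.
  by rewrite uniq_perm ?primes_uniq //= !inE neq_pq.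
move=> a b; rewrite !inE.
case/orP=> /eqP->; case/orP=> /eqP->; rewrite ?nadj // 1?prime_adjC ?nadj //.
  by rewrite /prime_adj eqxx.
by rewrite /prime_adj eqxx.
Qed.

Lemma prime_graph_is_edge3 (gT : finGroupType) (G : {group gT}) p q r :
    uniq [:: p; q; r] -> primes #|G| =i [:: p; q; r] -> prime_adj G p q ->
    (forall t, t \in [:: p; q] -> ~~ prime_adj G t r) ->
  prime_graph_is G [:: p; q; r] [:: (p, q)].
Proof.
move=> uV defV adj_pq nadj; split; first by rewrite uniq_perm ?primes_uniq.
have irr t : prime_adj G t t = false by rewrite /prime_adj eqxx.
have [np nq] : prime_adj G p r = false /\ prime_adj G q r = false.
  by split; apply/negbTE/nadj; rewrite !inE eqxx ?orbT.
move: uV; rewrite /= !inE negb_or andbT.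
case/andP=> /andP[/negPf neq_pq /negPf neq_pr] /negPf neq_qr.
have sym := prime_adjC G.
have neqs := (neq_pq, neq_pr, neq_qr, eqxx).
have neqs' : (q == p = false) * (r == p = false) * (r == q = false).
  by rewrite ![_ == p]eq_sym [r == q]eq_sym !neqs.
move=> a b; rewrite !inE !xpair_eqE.
case/or3P=> /eqP->; case/or3P=> /eqP->;
  by rewrite ?irr ?adj_pq ?[prime_adj G q p]sym ?[prime_adj G r _]sym
             ?adj_pq ?np ?nq ?neqs ?neqs'.
Qed.

Lemma prime_graph_is_edges4 (gT : finGroupType) (G : {group gT}) p q r s :
    uniq [:: p; q; r; s] -> primes #|G| =i [:: p; q; r; s] ->
    prime_adj G p q -> prime_adj G r s ->
    (forall t u, t \in [:: p; q] -> u \in [:: r; s] -> ~~ prime_adj G t u) ->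
  prime_graph_is G [:: p; q; r; s] [:: (p, q); (r, s)].
Proof.
move=> uV defV adj_pq adj_rs nadj; split; first by rewrite uniq_perm ?primes_uniq.
have irr t : prime_adj G t t = false by rewrite /prime_adj eqxx.
have n t u : t \in [:: p; q] -> u \in [:: r; s] -> prime_adj G t u = false.
  by move=> *; apply/negbTE/nadj.
have npr : prime_adj G p r = false by apply: n; rewrite !inE eqxx ?orbT.
have nps : prime_adj G p s = false by apply: n; rewrite !inE eqxx ?orbT.
have nqr : prime_adj G q r = false by apply: n; rewrite !inE eqxx ?orbT.
have nqs : prime_adj G q s = false by apply: n; rewrite !inE eqxx ?orbT.
have sym := prime_adjC G.
move: uV; rewrite /= !inE !negb_or !andbT.
case/and3P=> /and3P[/negPf n1 /negPf n2 /negPf n3].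
case/andP=> /negPf n4 /negPf n5 /negPf n6.
have neqs := (n1, n2, n3, n4, n5, n6, eqxx).
have neqs' : (q == p = false) * (r == p = false) * (s == p = false) *
             (r == q = false) * (s == q = false) * (s == r = false).
  by rewrite ![_ == p]eq_sym [r == q]eq_sym [s == q]eq_sym [s == r]eq_sym !neqs.
move=> a b; rewrite !inE !xpair_eqE.
case/or4P=> /eqP->; case/or4P=> /eqP->;
  by rewrite ?irr ?adj_pq ?adj_rs ?npr ?nps ?nqr ?nqs ?[prime_adj G q p]sym
    ?[prime_adj G s r]sym ?[prime_adj G r p]sym ?[prime_adj G r q]sym
    ?[prime_adj G s p]sym ?[prime_adj G s q]sym
    ?adj_pq ?adj_rs ?npr ?nps ?nqr ?nqs ?neqs ?neqs'.
Qed.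

(** * The Fitting subgroup is not of prime power order *)

Section FittingEdge.

Variables (gT : finGroupType) (G : {group gT}) (p q : nat) (x y : gT).
Hypotheses (solG : solvable G) (ecG : edge_root_closed G).
Hypothesis (disG : prime_graph_disconnected G).
Hypotheses (pr_p : prime p) (pr_q : prime q) (neq_pq : p != q).
Hypotheses (Gx : x \in G) (Gy : y \in G) (ox : #[x] = p) (oy : #[y] = q).
Hypotheses (cxy : commute x y) (defF : 'F(G) = <[x * y]>).

Let oxy : #[x * y] = (p * q)%N.
Proof. by have [] := commute_cycle pr_p pr_q neq_pq ox oy cxy. Qed.

Let nsFG : <[x * y]> <| G. Proof. by rewrite -defF Fitting_normal. Qed.

Let neq_qp : q != p. Proof. by rewrite eq_sym. Qed.

(** The automorphism group of a cyclic group is abelian, so the derived subgroup of [G] centralizes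
    ['F(G)] and lies in it. A prime far from [p] and [q] then bounds the powers of [p] and [q] in
    [#|G|], which makes ['F(G)] a Hall subgroup. *)
Lemma fitting_edge_sdprod :
  [/\ logn p #|G| = 1%N, logn q #|G| = 1%N &
   exists H : {group gT}, <[x * y]> ><| H = G /\ coprime #|<[x * y]>| #|H|].
Proof.
have sG'F : G^`(1) \subset <[x * y]>.
  apply: subset_trans (der1_cent_cyclic (normal_norm nsFG) (cycle_cyclic _)) _.
  by have := cent_sub_Fitting solG; rewrite defF.
have adj_pq := prime_adj_commute pr_p pr_q neq_pq Gx Gy ox oy cxy.
have /andP[Gp Gq] := prime_adj_primes pr_p pr_q adj_pq.
have [|r Gr [neq_rp neq_rq nrp nrq]] := disconnected_edge disG Gp Gq.
  by rewrite adj_pq orbT.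
move: Gr; rewrite mem_primes => /and3P[pr_r _ r_G].
have lp : logn p #|G| = 1%N.
  exact: (logn_card_nonadj solG pr_p pr_q neq_pq Gx Gy ox oy cxy sG'F pr_r).
have lq : logn q #|G| = 1%N.
  apply: (logn_card_nonadj solG pr_q pr_p neq_qp Gy Gx oy ox _ _ pr_r) => //.
  by rewrite -cxy.
split=> //.
have coF : coprime #|<[x * y]>| #|G : <[x * y]>|.
  rewrite -orderE oxy coprimeMl !prime_coprime // -!p'natE ?indexg_gt0 //.
  have lF: logn p #|<[x * y]>| = 1%N /\ logn q #|<[x * y]>| = 1%N.
    rewrite -orderE oxy !lognM ?prime_gt0 // !logn_prime // !eqxx.
    by rewrite (negPf neq_pq) (negPf neq_qp).
  have [lFp lFq] := lF.
  by rewrite !p'nat_index_logn1 ?normal_sub.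
have hallF: Hall G <[x * y]> by rewrite /Hall normal_sub.
have /splitsP[H /complP[tiFH defG]] := SchurZassenhaus_split hallF nsFG.
have [sHG nFH]: H \subset G /\ H \subset 'N(<[x * y]>).
  have sHG: H \subset G by rewrite -defG mulG_subr.
  by split=> //; apply: subset_trans sHG (normal_norm nsFG).
exists H; split; first by rewrite sdprodE.
move: coF; rewrite -divgS ?normal_sub // -defG TI_cardMg //.
by rewrite mulKn ?cardG_gt0.
Qed.

Lemma fitting_edge_normal : <[x]> <| G.
Proof.
apply: char_normal_trans nsFG.
rewrite (sub_cyclic_char _ (cycle_cyclic _)) cycle_subG.
by have [] := commute_cycle pr_p pr_q neq_pq ox oy cxy.
Qed.

(** [<[x]>] is a normal Sylow subgroup, so all elements of order [p] generate it; an element of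
    order [t] commuting with one of them would lie in [<[y]>] by [edge_cent]. *)
Lemma fitting_edge_nonadj t : logn p #|G| = 1%N -> prime t ->
  t != p -> t != q -> ~~ prime_adj G p t.
Proof.
move=> lp pr_t neq_tp neq_tq; apply/negP.
case/(prime_adjP pr_p pr_t)=> z [w [Gz Gw oz ow czw]].
have sylx: p.-Sylow(G) <[x]>.
  by rewrite pHallE normal_sub ?fitting_edge_normal //= p_part lp -orderE ox.
have xz: z \in <[x]>.
  by rewrite (mem_normal_Hall sylx fitting_edge_normal) ?(prime_elt pr_p).
have defz: <[z]> = <[x]> by exact: (cycle_prime_gen pr_p oz ox xz (cycle_id x)).
have xw: commute x w.
  have /cycleP[n ->]: x \in <[z]> by rewrite defz cycle_id.
  exact/commute_sym/commuteX/commute_sym.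
have /order_dvdG: w \in <[y]>.
  apply: (edge_cent ecG pr_p pr_q neq_pq Gx Gy ox oy cxy Gw xw).
  exact: prime_eltC ow.
by rewrite -orderE ow oy dvdn_prime2 // (negPf neq_tq).
Qed.

End FittingEdge.

(** The complement [H] of ['F(G)] acts fixed-point-freely, hence embeds in the cyclic group [Aut
    <[x]>]. If [H] is an [r]-group, [case_2a] results; otherwise [nilpotent_edge_root_closed]
    applied to [H] gives its order and [case_3] results. *)
Lemma fitting_edge (gT : finGroupType) (G : {group gT}) p q :
    solvable G -> edge_root_closed G -> prime_graph_disconnected G ->
    prime p -> prime q -> p != q -> p %| #|'F(G)| -> q %| #|'F(G)| ->
  case_2 G \/ case_3 G.
Proof.
move=> solG ecG disG pr_p pr_q neq_pq p_F q_F.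
have neq_qp : q != p by rewrite eq_sym.
have [x [y [[Fx Fy ox oy cxy] defF]]] := nilpotent_edge_root_closed
  (edge_root_closedS ecG (Fitting_sub G)) (Fitting_nil G) pr_p pr_q neq_pq p_F q_F.
have [Gx Gy]: x \in G /\ y \in G by rewrite !(subsetP (Fitting_sub G)).
have [oxy xyx xyy] := commute_cycle pr_p pr_q neq_pq ox oy cxy.
have [lp lq [H [defG coFH]]] := fitting_edge_sdprod solG disG pr_p pr_q neq_pq
  Gx Gy ox oy cxy defF.
have nadjp := fitting_edge_nonadj ecG pr_p pr_q neq_pq Gx Gy ox oy cxy defF lp.
have nadjq t : prime t -> t != p -> t != q -> ~~ prime_adj G q t.
  move=> pr_t tp tq;
    apply: (fitting_edge_nonadj ecG pr_q pr_p neq_qp Gy Gx oy ox) => //.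
  by rewrite -cxy.
have adj_pq := prime_adj_commute pr_p pr_q neq_pq Gx Gy ox oy cxy.
have [_ defFH nFH tiFH] := sdprodP defG.
have sHG: H \subset G by rewrite -defFH mulG_subr.
have H_neq t : t \in primes #|H| -> [/\ prime t, t != p & t != q].
  rewrite mem_primes => /and3P[pr_t _ t_H]; split=> //.
    apply: contraTneq coFH => eq_tp; rewrite -orderE oxy coprimeMl.
    by rewrite prime_coprime // -eq_tp t_H.
  apply: contraTneq coFH => eq_tq; rewrite -orderE oxy coprimeMl.
  by rewrite !prime_coprime // -eq_tq t_H andbF.
(* A fixed point would give commuting elements of prime orders, one dividing [p * q] and one
   dividing [#|H|]: an edge excluded by [nadjp] or [nadjq]. *)
have regH: semiregular <[x * y]> H.
  move=> h /setD1P[nth Hh]; apply/eqP; apply: contraT => ntC.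
  have [t pr_t t_h] : exists2 t, prime t & t %| #[h].
    by exists (pdiv #[h]); rewrite ?pdiv_dvd ?pdiv_prime // order_gt1.
  have [w hw ow] := cycle_Cauchy pr_t t_h.
  have Hw: w \in H by apply: subsetP hw; rewrite cycle_subG.
  have [_ tp tq] : [/\ prime t, t != p & t != q].
    by apply: H_neq; rewrite mem_primes pr_t cardG_gt0 -ow order_dvdG.
  have [s pr_s s_C] : exists2 s, prime s & s %| #|'C_<[x * y]>[h]|.
    by exists (pdiv #|'C_<[x * y]>[h]|);
      rewrite ?pdiv_dvd ?pdiv_prime // cardG_gt1.
  have [z /setIP[Fz chz] oz] := Cauchy pr_s s_C.
  have Gz: z \in G by rewrite (subsetP (Fitting_sub G)) // defF.
  have czw: commute z w.
    case/cycleP: hw => n ->; apply: commuteX; exact/cent1P.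
  have adj_st: s != t -> prime_adj G s t.
    by move=> neq_st; apply: (prime_adj_commute pr_s pr_t neq_st Gz _ oz ow) => //;
      apply: (subsetP sHG).
  have: s %| p * q by rewrite -oxy -oz order_dvdG.
  rewrite Euclid_dvdM // !dvdn_prime2 // => /orP[]/eqP def_s;
    rewrite def_s in adj_st.
    by case/negP: (nadjp t pr_t tp tq); apply: adj_st; rewrite eq_sym.
  by case/negP: (nadjq t pr_t tp tq); apply: adj_st; rewrite eq_sym.
have nsx := fitting_edge_normal pr_p pr_q neq_pq ox oy cxy defF.
have nsy: <[y]> <| G.
  by apply: (fitting_edge_normal pr_q pr_p neq_qp oy ox) => //; rewrite -cxy.
have regx: semiregular <[x]> H.
  by apply: semiregularS regH; rewrite ?cycle_subG.
have regy: semiregular <[y]> H.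
  by apply: semiregularS regH; rewrite ?cycle_subG.
have dvdp: #|H| %| p - 1.
  have := regular_norm_dvd_pred (subset_trans sHG (normal_norm nsx)) regx.
  by rewrite -orderE ox subn1.
have dvdq: #|H| %| q - 1.
  have := regular_norm_dvd_pred (subset_trans sHG (normal_norm nsy)) regy.
  by rewrite -orderE oy subn1.
have cycH: cyclic H.
  have prx: prime #|<[x]>| by rewrite -orderE ox.
  have := quotient_cent_prime_cyclic (subset_trans sHG (normal_norm nsx)) prx.
  suff ->: 'C_H(<[x]>) = 1 by rewrite -(isog_cyclic (quotient1_isog H)).
  rewrite cent_cycle; apply: (semiregular_sym regx).
  by rewrite !inE cycle_id (prime_neq1 pr_p ox).
have primesG t : (t \in primes #|G|) = [|| t == p, t == q | t \in primes #|H|].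
  rewrite -(sdprod_card defG) primesM ?cardG_gt0 // -orderE oxy.
  by rewrite primesM ?prime_gt0 // (primes_prime pr_p) (primes_prime pr_q) !inE orbA.
have cycG : cyclic_of_order (p * q) <[x * y]> by split; rewrite ?cycle_cyclic.
have nadj t u : t \in [:: p; q] -> u \in primes #|H| -> ~~ prime_adj G t u.
  by rewrite !inE => /orP[]/eqP-> /H_neq[]; [apply: nadjp | apply: nadjq].
have /andP[Gp Gq] := prime_adj_primes pr_p pr_q adj_pq.
have [|r Gr [neq_rp neq_rq _ _]] := disconnected_edge disG Gp Gq.
  by rewrite adj_pq orbT.
have Hr: r \in primes #|H|.
  by move: Gr; rewrite primesG (negPf neq_rp) (negPf neq_rq).
have [pr_r _ _] := H_neq r Hr.
case: (boolP (r.-group H)) => [rH | ].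
  left; exists p, q, r; have cardH := card_pgroup rH.
  have lr: 0 < logn r #|H| by rewrite logn_gt0.
  split; last first.
    left; exists (logn r #|H|); rewrite -cardH; split=> //.
    by exists <[x * y]>%G, H.
  apply: prime_graph_is_edge3 => //.
  - by rewrite /= !inE negb_or neq_pq ![_ == r]eq_sym neq_rp neq_rq.
  - by move=> t; rewrite primesG cardH primesX // (primes_prime pr_r) !inE.
  by move=> t pqt; apply: nadj.
rewrite /pgroup /pnat cardG_gt0 /= => /allPn[s Hs]; rewrite inE => neq_sr.
have [pr_s neq_sp neq_sq] := H_neq s Hs.
have neq_rs: r != s by rewrite eq_sym.
have [r_H s_H]: r %| #|H| /\ s %| #|H|.
  by move: Hr Hs; rewrite !mem_primes => /and3P[_ _ ->] /and3P[_ _ ->].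
have [v [w [[Hv Hw ov ow cvw] defH]]] := nilpotent_edge_root_closed
  (edge_root_closedS ecG sHG) (abelian_nil (cyclic_abelian cycH))
  pr_r pr_s neq_rs r_H s_H.
have [ovw _ _] := commute_cycle pr_r pr_s neq_rs ov ow cvw.
have cardH: #|H| = (r * s)%N by rewrite defH -orderE.
(* The first two primes of [case_3] belong to the complement, so [r] and [s] come first. *)
right; exists r, s, p, q; rewrite -cardH; split=> //; last first.
  by exists <[x * y]>%G, H.
apply: prime_graph_is_edges4 => //.
- by rewrite /= !inE !negb_or neq_rs neq_rp neq_rq neq_sp neq_sq neq_pq.
- move=> t; rewrite primesG cardH primesM ?prime_gt0 //
    (primes_prime pr_r) (primes_prime pr_s) !inE.
  by rewrite orbA orbC -orbA.
- by apply: (prime_adj_commute pr_r pr_s neq_rs _ _ ov ow cvw); apply: (subsetP sHG).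
move=> t u rst pqu; rewrite prime_adjC; apply: nadj => //.
by rewrite cardH primesM ?prime_gt0 // (primes_prime pr_r) (primes_prime pr_s) -mem_cat.
Qed.

(** * The Fitting subgroup has prime power order *)

Lemma prime_order_cycle (gT : finGroupType) (x y : gT) p : prime p ->
  #[x] = p -> y \in <[x]> -> y != 1 -> #[y] = p.
Proof.
move=> pr_p ox xy nty; have: #[y] %| p by rewrite -ox order_dvdG.
case/primeP: pr_p => _ dv /dv /orP[|/eqP//].
by rewrite order_eq1 (negPf nty).
Qed.

Lemma cycle_prime_mem (gT : finGroupType) (c x y : gT) p : prime p ->
  #[x] = p -> #[y] = p -> x \in <[c]> -> y \in <[c]> -> x \in <[y]>.
Proof.
move=> pr_p ox oy cx cy.
by rewrite -(cycle_prime_gen pr_p ox oy cx cy) cycle_id.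
Qed.

Section FittingPgroup.

Variables (gT : finGroupType) (G : {group gT}) (r : nat).
Hypotheses (solG : solvable G) (ecG : edge_root_closed G).
Hypotheses (pr_r : prime r) (rF : r.-group 'F(G)) (ntF : 'F(G) != 1).
Implicit Types (p q s t : nat) (g x y z : gT).

Let V := 'Z('F(G))%G.

Let abelV : abelian V. Proof. exact: center_abelian. Qed.

Let nVG : G \subset 'N(V).
Proof. exact: char_norm_trans (center_char _) (gFnorm _ _). Qed.

Let sVF : V \subset 'F(G). Proof. exact: center_sub. Qed.

Let rV : r.-group V. Proof. exact: pgroupS rF. Qed.

Let ntV : V :!=: 1.
Proof. by rewrite /V /= (center_nil_eq1 (Fitting_nil G)). Qed.

(* An element y of prime order s <> r commuting with some x of order r in V
   would generate the only subgroup of order s of 'C_G[x], hence be normalized,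
   and so centralized, by 'F(G). *)
Lemma cent_Fitting_center_pelt g : g \in G -> g != 1 -> r^'.-elt g ->
  'C_V[g] = 1.
Proof.
move=> Gg ntg r'g; apply/eqP; apply: contraT => ntC.
have [_ r_C _] := pgroup_pdiv (pgroupS (subsetIl _ _) rV) ntC.
have [x /setIP[Vx cgx] ox] := Cauchy pr_r r_C.
pose s := pdiv #[g]; have pr_s : prime s by rewrite pdiv_prime // order_gt1.
have [y gy oy] := cycle_Cauchy pr_s (pdiv_dvd #[g]).
have neq_sr: s != r.
  by apply: (pnatPpi r'g); rewrite mem_primes pr_s order_gt0 pdiv_dvd.
have neq_rs: r != s by rewrite eq_sym.
have sGF := subsetP (Fitting_sub G).
have Fx := subsetP sVF x Vx; have Gx := sGF x Fx.
have Gy: y \in G by apply: subsetP gy; rewrite cycle_subG.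
have cxy: commute x y by case/cycleP: gy => n ->; apply/commuteX/cent1P.
have nyF: 'F(G) \subset 'N(<[y]>).
  apply/subsetP=> f Ff; rewrite inE -cycleJ cycle_subG.
  have xf: x ^ f = x.
    by apply/conjg_fixP/commgP; case/centerP: Vx => _; apply.
  apply: (edge_cent ecG pr_r pr_s neq_rs Gx Gy ox oy cxy).
  - by rewrite groupJ // sGF.
  - by have := congr1 (conjg^~ f) cxy; rewrite /= !conjMg xf.
  by rewrite p_eltJ; apply: prime_eltC oy.
have cFy: y \in 'C('F(G)).
  rewrite -cycle_subG centsC (sameP commG1P trivgP).
  have coFy: coprime #|'F(G)| #|<[y]>|.
    by rewrite (pnat_coprime rF) // -orderE; apply: (prime_eltC pr_s pr_r).
  rewrite -(coprime_TIg coFy) subsetI commg_subr nyF andbT commg_subl.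
  by rewrite cycle_subG (subsetP (gFnorm _ _) y Gy).
have: y \in 'F(G) by apply: (subsetP (cent_sub_Fitting solG)); rewrite inE Gy.
move/(mem_p_elt rF)/pnat_1/(_ (prime_eltC pr_s pr_r neq_sr oy)) => y1.
by rewrite y1 in oy; rewrite -oy in pr_s.
Qed.

Let coVs s : prime s -> s != r -> coprime #|V| s.
Proof.
by move=> pr_s neq_sr; rewrite (pnat_coprime rV) // pnatE.
Qed.

(** Otherwise [x] and [y] generate an elementary abelian group of order [s ^ 2] whose non-trivial
    elements all act fixed-point-freely on [V], against [fpf_commute_cycle]. *)
Lemma commute_prime_cycle s x y : prime s -> s != r -> x \in G -> y \in G ->
  #[x] = s -> #[y] = s -> commute x y -> y \in <[x]>.
Proof.
move=> pr_s neq_sr Gx Gy ox oy cxy; apply: contraT => xy.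
have fpf z : z \in G -> z != 1 -> z ^+ s = 1 -> 'C_V[z] = 1.
  move=> Gz ntz zs; apply: cent_Fitting_center_pelt => //.
  apply: (pnat_dvd (n := s)); first by rewrite order_dvdn zs.
  by rewrite pnatE.
have sub k : k \in <[x]> -> k \in G by apply: subsetP; rewrite cycle_subG.
have sx k : k \in <[x]> -> k ^+ s = 1.
  by case/cycleP=> n ->; rewrite -expgM mulnC expgM -ox expg_order expg1n.
case: (fpf_commute_cycle abelV pr_s (coVs pr_s neq_sr) _ _ ox oy cxy).
- exact: (subsetP nVG).
- exact: (subsetP nVG).
- by move=> k /setD1P[ntk xk]; apply: fpf; rewrite ?sub ?sx.
- move=> k xk; apply: fpf; first by rewrite groupM // sub.
    by apply: contraNneq xy => yk1; rewrite -(mulgK k y) yk1 mul1g groupV.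
  rewrite expgMn; first by rewrite (sx k) // mulg1 -oy expg_order.
  by case/cycleP: xk => n ->; apply/commuteX/commute_sym.
- by rewrite (negPf xy).
by move=> V1; case/eqP: ntV.
Qed.

(** If [y] did not centralize [x], then [<[y]>] would act fixed-point-freely on [<[x]>], while both
    groups act so on [V], against [fpf_sdprod_trivg]. *)
Lemma norm_prime_commute s t x y : prime s -> prime t -> s != r -> t != r ->
  x \in G -> y \in G -> #[x] = s -> #[y] = t -> y \in 'N(<[x]>) -> commute x y.
Proof.
move=> pr_s pr_t neq_sr neq_tr Gx Gy ox oy nxy.
have fpf z p : prime p -> p != r -> z \in G -> #[z] = p -> 'C_V(<[z]>) = 1.
  move=> pr_p neq_pr Gz oz; rewrite cent_cycle cent_Fitting_center_pelt //.
    exact: prime_neq1 pr_p oz.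
  exact: (prime_eltC pr_p pr_r).
have [cxy|ncxy] := boolP (y \in 'C[x]); first exact/commute_sym/cent1P.
case/eqP: ntV; apply: (@fpf_sdprod_trivg _ V abelV <[x]>%G <[y]>%G) => //.
- by rewrite cycle_subG (subsetP nVG).
- by rewrite cycle_subG (subsetP nVG).
- by rewrite cycle_subG.
- by rewrite -orderE ox coVs.
- exact: (fpf x s).
- exact: (fpf y t).
move=> h /setD1P[nth yh]; apply: prime_TIg; first by rewrite -orderE ox.
apply: contra ncxy; rewrite cycle_subG => chx.
have oh := prime_order_cycle pr_t oy yh nth.
have: y \in <[h]> by exact: (cycle_prime_mem pr_t oy oh (cycle_id y) yh).
by apply: subsetP; rewrite cycle_subG cent1C.
Qed.

(** In a Hall [r']-subgroup [H] a non-trivial normal elementary abelian subgroup has the form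
    [<[x]>], by [commute_prime_cycle]. Elements of other prime orders in [H] normalize [<[x]>],
    hence commute with [x]. So [u] is adjacent to every further prime except possibly [r]. *)
Lemma normal_prime_elt : ~~ r.-group G -> exists u x,
  [/\ prime u, u != r, x \in G, #[x] = u &
    forall t, prime t -> t %| #|G| -> t != r -> t != u ->
      exists y, [/\ y \in G, #[y] = t & commute x y]].
Proof.
move=> nrG; have [H hallH] := Hall_exists r^' solG.
have sHG := pHall_sub hallH; have r'H := pHall_pgroup hallH.
have dvdH t : prime t -> t %| #|G| -> t != r -> t %| #|H|.
  move=> pr_t t_G neq_tr; rewrite (card_Hall hallH).
  by rewrite -(part_pnat_id (_ : r^'.-nat t)) ?partn_dvd // pnatE.
have ntH: H :!=: 1.
  apply: contra nrG => /eqP H1; have := card_Hall hallH.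
  by rewrite H1 cards1 => /esym/eqP; rewrite partn_eq1 ?cardG_gt0 // pnatNK.
have [U [sUH nsUH ntU /is_abelemP[u pr_u abelU]]] :=
  solvable_norm_abelem (solvableS sHG solG) (normal_refl H) ntH.
have [uU cUU expU] := and3P abelU.
have [_ u_U _] := pgroup_pdiv (abelem_pgroup abelU) ntU.
have [x Ux ox] := Cauchy pr_u u_U.
have neq_ur: u != r.
  by apply: (pnatPpi r'H); rewrite mem_primes pr_u cardG_gt0
    (dvdn_trans u_U) ?cardSg.
have sGU z : z \in U -> z \in G by move/(subsetP sUH)/(subsetP sHG).
have defU: U :=: <[x]>.
  apply/eqP; rewrite eqEsubset cycle_subG Ux andbT; apply/subsetP=> z Uz.
  have [->|ntz] := eqVneq z 1; first exact: group1.
  apply: (commute_prime_cycle pr_u neq_ur); rewrite ?sGU //.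
    exact: abelem_order_p abelU Uz ntz.
  exact: (centsP (abelem_abelian abelU)).
exists u, x; split; rewrite ?sGU // => t pr_t t_G neq_tr neq_tu.
have [y Hy oy] := Cauchy pr_t (dvdH t pr_t t_G neq_tr).
have Gy := subsetP sHG y Hy.
exists y; split=> //.
apply: (norm_prime_commute pr_u pr_t neq_ur neq_tr _ Gy ox oy); first exact: sGU.
by rewrite -defU (subsetP (normal_norm nsUH)).
Qed.

Lemma sylow_prime_elt s (P : {group gT}) : prime s -> s != r ->
    P \subset G -> s.-group P -> P :!=: 1 ->
  exists x, [/\ x \in P, #[x] = s & forall z, z \in P -> #[z] = s -> z \in <[x]>].
Proof.
move=> pr_s neq_sr sPG sP ntP.
have ntZ: 'Z(P) != 1 by rewrite (center_nil_eq1 (pgroup_nil sP)).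
have [_ s_Z _] := pgroup_pdiv (pgroupS (center_sub P) sP) ntZ.
have [x Zx ox] := Cauchy pr_s s_Z; have [Px cPx] := centerP _ _ Zx.
exists x; split=> // z Pz oz.
by apply: commute_prime_cycle oz _; rewrite ?(subsetP sPG) //; apply: cPx.
Qed.

(** As an [r]-group, ['F(G)] is the [r]-core of [G], so [G / 'F(G)] has trivial [r]-core. *)
Lemma Fitting_quotient_pgroup : r^'.-group 'F(G / 'F(G)).
Proof.
have defF: 'F(G) = 'O_r(G) by rewrite -p_core_Fitting pcore_pgroup_id.
have trQ: 'O_r(G / 'F(G)) = 1 by rewrite defF trivg_pcore_quotient.
have := nilpotent_pcoreC r (Fitting_nil (G / 'F(G))).
rewrite p_core_Fitting trQ dprod1g => <-.
exact: pcore_pgroup.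
Qed.

Lemma Fitting2_quotient : Fitting2 G / 'F(G) = 'F(G / 'F(G)).
Proof. by rewrite /= cosetpreK. Qed.

Lemma Fitting2_normal : Fitting2 G <| G.
Proof.
rewrite -[X in _ <| X](quotientGK (Fitting_normal G)).
by rewrite cosetpre_normal Fitting_normal.
Qed.

(** Modulo ['F(G)] the order of [g] is divisible by a prime [s] other than [r]. A non-trivial fixed
    point of [g] in the [r]-group ['F(G)] would give an edge between [r] and [s]. *)
Lemma Fitting2_fpf : (forall s, prime s -> ~~ prime_adj G r s) ->
  quo_acts_fpf (Fitting2 G) 'F(G).
Proof.
move=> iso_r g /setDP[F2g Fg]; apply/eqP; apply: contraT => ntC.
have Gg: g \in G by rewrite (subsetP (normal_sub Fitting2_normal)).
have Ng: g \in 'N('F(G)) by rewrite (subsetP (gFnorm _ _)).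
have ntg: coset 'F(G) g != 1.
  by apply: contra Fg => /eqP/coset_idr; apply.
have Kg: coset 'F(G) g \in 'F(G / 'F(G)) by rewrite -Fitting2_quotient mem_quotient.
pose s := pdiv #[coset 'F(G) g].
have pr_s: prime s by rewrite pdiv_prime // order_gt1.
have s_g: s %| #[g] by rewrite (dvdn_trans (pdiv_dvd _)) // morph_order.
have neq_sr: s != r.
  apply: (pnatPpi (mem_p_elt Fitting_quotient_pgroup Kg)).
  by rewrite mem_primes pr_s order_gt0 pdiv_dvd.
have [y gy oy] := cycle_Cauchy pr_s s_g.
have Gy: y \in G by apply: subsetP gy; rewrite cycle_subG.
have [_ r_C _] := pgroup_pdiv (pgroupS (subsetIl _ _) rF) ntC.
have [x /setIP[Fx cgx] ox] := Cauchy pr_r r_C.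
case/negP: (iso_r s pr_s).
apply: (prime_adj_commute pr_r pr_s _ _ Gy ox oy); first by rewrite eq_sym.
  exact: subsetP (Fitting_sub G) x Fx.
by case/cycleP: gy => n ->; apply/commuteX/cent1P.
Qed.

(** A Sylow [p]-subgroup [P] containing [x] has only one subgroup of order [p]. So every non-trivial
    element of [P] is a root of [x], and [edge_root_pelt] puts it in [<[x]>]. *)
Lemma card_Sylow_edge p q x y : prime p -> prime q -> p != q -> p != r ->
    x \in G -> y \in G -> #[x] = p -> #[y] = q -> commute x y ->
  logn p #|G| = 1%N.
Proof.
move=> pr_p pr_q neq_pq neq_pr Gx Gy ox oy cxy.
have sxG: <[x]> \subset G by rewrite cycle_subG.
have p_x: p.-group <[x]> by apply: prime_elt ox.
have [P sylP sxP] := Sylow_superset sxG p_x.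
have [sPG pP _] := and3P sylP.
have Px: x \in P by rewrite -cycle_subG.
have ntP: P :!=: 1.
  by apply/trivgPn; exists x; rewrite ?(prime_neq1 pr_p ox).
have [x0 [Px0 ox0 x0P]] := sylow_prime_elt pr_p neq_pr sPG pP ntP.
suff defP: P :=: <[x]>.
  by rewrite -(logn_part p) -(card_Hall sylP) defP -orderE ox logn_prime ?eqxx.
apply/eqP; rewrite eqEsubset sxP andbT; apply/subsetP=> a Pa.
have [->|nta] := eqVneq a 1; first exact: group1.
have Ga := subsetP sPG a Pa; have p_a := mem_p_elt pP Pa.
have [k oa] := p_natP p_a.
have p_dvd_a: p %| #[a].
  by rewrite oa dvdn_exp // lt0n; apply: contraNneq nta => k0;
    rewrite -order_eq1 oa k0.
have [w aw ow] := cycle_Cauchy pr_p p_dvd_a.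
have Pw: w \in P by apply: subsetP aw; rewrite cycle_subG.
apply: (edge_root_pelt ecG pr_p pr_q neq_pq Gx Gy ox oy cxy Ga p_a).
apply: cycle_trans aw.
exact: (cycle_prime_mem pr_p ox ow (x0P x Px ox) (x0P w Pw ow)).
Qed.

Let Q := (G / 'F(G))%G.
Let K := 'F(Q)%G.

(** [K] is a [u]-group with a single subgroup [<[k]>] of order [u], hence cyclic or generalized
    quaternion, and it is the centralizer of [<[k]>] in [Q]. In the quaternion case [Q = K]; in the
    cyclic case [Q / K] embeds in [Aut <[k]>], of order [u - 1], so [K] has a complement, an
    [r]-group. *)
Lemma Fitting_pgroup_single u : prime u -> u != r -> primes #|G| =i [:: r; u] ->
  ~~ prime_adj G r u -> case_1 G.
Proof.
move=> pr_u neq_ur defV nadj.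
have neq_ru: r != u by rewrite eq_sym.
split; first by exists r, u; apply: prime_graph_is_empty2.
have iso_r s : prime s -> ~~ prime_adj G r s.
  move=> pr_s; apply/negP=> adj_rs.
  have /andP[_] := prime_adj_primes pr_r pr_s adj_rs.
  rewrite defV !inE => /orP[]/eqP def_s; last by rewrite -def_s adj_rs in nadj.
  by move: adj_rs; rewrite def_s /prime_adj eqxx.
have primesS t (rT : finGroupType) (A : {group rT}) :
    #|A| %| #|G| -> t \in primes #|A| -> (t == r) || (t == u).
  move=> A_G; rewrite mem_primes => /and3P[pr_t _ t_A].
  have: t \in primes #|G| by rewrite mem_primes pr_t cardG_gt0 (dvdn_trans t_A).
  by rewrite defV !inE.
have dvdQ : #|Q| %| #|G| by apply: dvdn_quotient.
have sKQ : K \subset Q by apply: Fitting_sub.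
have uK : u.-group K.
  apply: sub_in_pnat Fitting_quotient_pgroup => t t_K; rewrite !inE => neq_tr.
  have := primesS t _ K (dvdn_trans (cardSg sKQ) dvdQ) t_K.
  by rewrite (negPf neq_tr).
exists r; split=> //; last exact: Fitting2_fpf.
have solQ : solvable Q by apply: quotient_sol.
have ntK : K :!=: 1.
  rewrite /K /= (trivg_Fitting solQ); apply/negP=> /eqP/trivgP Q1.
  rewrite quotient_sub1 ?gFnorm // in Q1.
  have Gu: u \in primes #|G| by rewrite defV !inE eqxx orbT.
  by have := pnatPpi (pgroupS Q1 rF) Gu; rewrite inE (negPf neq_ur).
have [_ u_K _] := pgroup_pdiv uK ntK.
have ntZ: 'Z(K) != 1 by rewrite (center_nil_eq1 (pgroup_nil uK)).
have [_ u_Z _] := pgroup_pdiv (pgroupS (center_sub K) uK) ntZ.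
have [k Zk ok] := Cauchy pr_u u_Z; have [Kk cKk] := centerP _ _ Zk.
(* [K] lies in the image of a Sylow [u]-subgroup [S] of [G], and [S] meets ['F(G)] trivially, so
   elements of order [u] in [K] lift to elements of order [u] in [S]. *)
have k_uniq (z : coset_of 'F(G)) : z \in K -> #[z] = u -> z \in <[k]>.
  have [S sylS] := Sylow_exists u G; have [sSG uS _] := and3P sylS.
  have nFS: S \subset 'N('F(G)) by apply: subset_trans sSG (gFnorm _ _).
  have tiFS: 'F(G) :&: S = 1.
    rewrite coprime_TIg // (pnat_coprime rF) //.
    by apply: sub_in_pnat uS => t _ /eqP->; rewrite !inE.
  have sKS: K \subset S / 'F(G).
    apply: subset_trans (pcore_sub_Hall (quotient_pHall nFS sylS)).
    by apply: pcore_max; rewrite // Fitting_normal.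
  have ntS: S :!=: 1.
    apply: contraNneq ntK => S1; rewrite -subG1 (subset_trans sKS) //.
    by rewrite S1 quotient1.
  have [x [Sx ox xS]] := sylow_prime_elt pr_u neq_ur sSG uS ntS.
  have liftS (w : coset_of 'F(G)) : w \in K -> #[w] = u -> w \in <[coset 'F(G) x]>.
    move=> Kw ow; have /morphimP[v Nv Sv def_w] := subsetP sKS w Kw.
    have ov: #[v] = u.
      apply: nt_prime_order => //; last first.
        apply: contraNneq (prime_neq1 pr_u ow) => v1.
        by rewrite def_w v1 morph1.
      apply/set1gP; rewrite -tiFS; apply/setIP; split; last exact: groupX.
      by rewrite coset_idr ?groupX // morphX // -def_w -ow expg_order.
    have /cycleP[n def_v] := xS v Sv ov.
    by rewrite def_w def_v morphX ?mem_cycle // (subsetP nFS).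
  move=> Kz oz.
  exact: (cycle_prime_mem pr_u oz ok (liftS z Kz oz) (liftS k Kk ok)).
have defX: 'Ohm_1(K) = <[k]>.
  apply/eqP; rewrite eqEsubset (OhmE 1 uK) gen_subG cycle_subG; apply/andP; split.
    apply/subsetP=> z /LdivP[Kz]; rewrite expn1 => zu.
    have [->|ntz] := eqVneq z 1; first exact: group1.
    by rewrite k_uniq // (nt_prime_order pr_u).
  by apply/mem_gen/LdivP; rewrite expn1 -ok expg_order.
have oX : #|'Ohm_1(K)| = u by rewrite defX -orderE.
have nsXQ : <[k]> <| Q.
  rewrite -defX; apply: char_normal_trans (Ohm_char 1 K) _.
  exact: Fitting_normal.
have nadjQ (z w : coset_of 'F(G)) : z \in Q -> w \in Q ->
    #[z] = r -> #[w] = u -> ~ commute z w.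
  move=> Qz Qw oz ow czw; case/negP: nadj.
  apply: (prime_adj_quotient pr_r pr_u (Fitting_normal G)).
  exact: prime_adj_commute ow czw.
have Qk := subsetP sKQ k Kk.
(* The centralizer of [k] has no element of order [r], so it is a normal [u]-subgroup of [Q]. *)
have defK: 'C_Q(<[k]>) = K.
  apply/eqP; rewrite eqEsubset; apply/andP; split; last first.
    rewrite subsetI sKQ cent_cycle; apply/subsetP=> z Kz.
    exact/cent1P/commute_sym/cKk.
  have uC : u.-group 'C_Q(<[k]>).
    rewrite /pgroup; apply/pnatP=> // t pr_t t_C.
    have := primesS t _ 'C_Q(<[k]>)%G
      (dvdn_trans (cardSg (subsetIl _ _)) dvdQ).
    rewrite mem_primes pr_t cardG_gt0 t_C => /(_ isT)/orP[/eqP tr|//].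
    have [z /setIP[Qz cz] oz] := Cauchy pr_t t_C.
    case: (nadjQ z k) => //; first by rewrite oz.
    by apply: (centP cz); apply: cycle_id.
  apply: Fitting_max (pgroup_nil uC).
  by rewrite /normal subsetIl normsI ?normG // norms_cent ?normal_norm.
have /(prime_Ohm1P uK ntK)/orP[cycK | /andP[/eqP u2 /eqP qK]] := oX; last first.
  (* As [u] is 2, [k] is the only non-trivial element of the normal subgroup [<[k]>], hence central
     in [Q]. *)
  left; have QK : Q :=: K.
    rewrite -defK; apply/esym/setIidPl; rewrite cent_cycle.
    apply/subsetP=> z Qz; apply/cent1P.
    have: k ^ z \in <[k]>.
      by rewrite memJ_norm ?cycle_id // (subsetP (normal_norm nsXQ)).
    rewrite cycle2g ?ok // !inE conjg_eq1 (negPf (prime_neq1 pr_u ok)) /=.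
    by move/eqP/conjg_fixP/commgP/commute_sym.
  have [n n_gt2 isoK] := proj1 (quaternion_classP K) qK.
  by exists n => //; rewrite -[G / 'F(G)]/(gval Q) QK.
right.
have nsKQ : K <| Q by apply: Fitting_normal.
have prX : prime #|<[k]>| by rewrite -orderE ok.
have cycQK : cyclic (Q / K).
  by have := quotient_cent_prime_cyclic (normal_norm nsXQ) prX; rewrite defK.
have u'QK : u^'.-nat #|Q : K|.
  rewrite -card_quotient ?normal_norm //.
  have [B sBA] := quotient_cent_conj_aut (normal_norm nsXQ).
  rewrite defK => isoB.
  rewrite (card_isog isoB); apply: pnat_dvd (cardSg sBA) _.
  rewrite card_Aut_cyclic ?cycle_cyclic // -orderE ok totient_prime // p'natE //.
  rewrite gtnNdvd //; last by rewrite prednK ?prime_gt0.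
  by rewrite -subn1 subn_gt0 prime_gt1.
have hallK : u.-Hall(Q) K by rewrite /pHall sKQ uK.
have /splitsP[P /complP[tiKP defQ]] := SchurZassenhaus_split (pHall_Hall hallK) nsKQ.
have sPQ : P \subset Q by rewrite -defQ mulG_subr.
have sdQ : K ><| P = Q by rewrite sdprodE // (subset_trans sPQ) ?normal_norm.
have rP : r.-group P.
  apply/pnatP=> // t pr_t t_P; have Pt : t \in primes #|P|.
    by rewrite mem_primes pr_t cardG_gt0.
  case/orP: (primesS t _ P (dvdn_trans (cardSg sPQ) dvdQ) Pt) => // /eqP tu.
  have := pnatPpi u'QK; rewrite -divgS // -defQ TI_cardMg // mulKn ?cardG_gt0 //.
  by move/(_ t Pt); rewrite !inE tu eqxx.
(* [Q] is the entire semidirect product [K ><| P] and is taken as its own subgroup; a trivial [P]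
   gives the exponent 0. *)
exists u, (logn u #|K|), (logn r #|P|), (coset_of 'F(G)), Q, K, P, Q.
split=> //; last exact: isog_refl.
- by split=> //; apply/eqP.
- split=> //; split=> //; try exact: card_pgroup.
  by rewrite (isog_cyclic (sdprod_isog sdQ)).
move=> _ h /setD1P[nth Ph]; apply/eqP; apply: contraT => ntC.
have [_ u_C _] := pgroup_pdiv (pgroupS (subsetIl _ _) uK) ntC.
have [w /setIP[Kw chw] ow] := Cauchy pr_u u_C.
have [n oh] := p_natP (mem_p_elt rP Ph).
have r_h: r %| #[h].
  by rewrite oh dvdn_exp // lt0n; apply: contraNneq nth => n0;
    rewrite -order_eq1 oh n0.
have [z hz oz] := cycle_Cauchy pr_r r_h.
have Qz : z \in Q.
  by apply: subsetP hz; rewrite cycle_subG (subsetP sPQ).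
case: (nadjQ z w) => //; first exact: (subsetP sKQ).
by case/cycleP: hz => m ->; apply/commute_sym/commuteX/cent1P.
Qed.

(** Up to a power of [r], [#|G|] is [p * q], so [x * y] generates a Hall [r']-subgroup, which maps
    isomorphically onto [K]. As [r] is isolated, the [r]-group [Q / K] acts on [K] without fixed
    points; it therefore embeds in the automorphism group of a group of order [p] and is cyclic. *)
Lemma Fitting_pgroup_edge p q x y : prime p -> prime q -> p != q ->
    p != r -> q != r -> primes #|G| =i [:: p; q; r] ->
    x \in G -> y \in G -> #[x] = p -> #[y] = q -> commute x y ->
    ~~ prime_adj G r p -> ~~ prime_adj G r q ->
  case_2 G.
Proof.
move=> pr_p pr_q neq_pq neq_pr neq_qr defV Gx Gy ox oy cxy nadjp nadjq.
have neq_qp : q != p by rewrite eq_sym.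
have adj_pq := prime_adj_commute pr_p pr_q neq_pq Gx Gy ox oy cxy.
have iso_r s : prime s -> ~~ prime_adj G r s.
  move=> pr_s; apply/negP=> adj_rs.
  have /andP[_] := prime_adj_primes pr_r pr_s adj_rs.
  rewrite defV !inE => /or3P[]/eqP def_s.
  - by rewrite -def_s adj_rs in nadjp.
  - by rewrite -def_s adj_rs in nadjq.
  by move: adj_rs; rewrite def_s /prime_adj eqxx.
exists p, q, r; split.
  apply: prime_graph_is_edge3 => //.
    by rewrite /= !inE negb_or neq_pq neq_pr neq_qr.
  by move=> t; rewrite !inE prime_adjC => /orP[]/eqP->; apply: iso_r.
right; set c := x * y.
have [oc xc yc] := commute_cycle pr_p pr_q neq_pq ox oy cxy.
have lp := card_Sylow_edge pr_p pr_q neq_pq neq_pr Gx Gy ox oy cxy.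
have lq := card_Sylow_edge pr_q pr_p neq_qp neq_qr Gy Gx oy ox (commute_sym cxy).
have scG : <[c]> \subset G by rewrite cycle_subG groupM.
have [lcp lcq] : logn p #|<[c]>| = 1%N /\ logn q #|<[c]>| = 1%N.
  rewrite -orderE oc !lognM ?prime_gt0 // !logn_prime // !eqxx.
  by rewrite (negPf neq_pq) (negPf neq_qp).
have hallc : r^'.-Hall(G) <[c]>.
  rewrite /pHall scG /pgroup -orderE oc pnatM (pnatE _ pr_p) (pnatE _ pr_q).
  rewrite !inE neq_pr neq_qr /=.
  apply/pnatP=> // t pr_t t_i; rewrite !inE negbK.
  have: t \in primes #|G|.
    by rewrite mem_primes pr_t cardG_gt0 (dvdn_trans t_i) ?dvdn_indexg.
  rewrite defV !inE => /or3P[]/eqP// def_t; move: t_i; rewrite def_t.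
    by have := p'nat_index_logn1 pr_p scG lp lcp; rewrite p'natE // => /negPf->.
  by have := p'nat_index_logn1 pr_q scG lq lcq; rewrite p'natE // => /negPf->.
have tiFc : 'F(G) :&: <[c]> = 1.
  rewrite coprime_TIg // (pnat_coprime rF) //.
  exact: pHall_pgroup hallc.
have nFG : G \subset 'N('F(G)) by apply: gFnorm.
have nFc : <[c]> \subset 'N('F(G)) by apply: subset_trans nFG.
have hallcF := quotient_pHall nFc hallc.
have sKQ : K \subset Q by apply: Fitting_sub.
have nsKQ : K <| Q by apply: Fitting_normal.
(* A normal [r']-subgroup lies in every Hall [r']-subgroup, so [K] lies in the image of [<[c]>];
   that image is abelian and centralizes [K], which contains its own centralizer. *)
have defK : K :=: <[c]> / 'F(G).
  apply/eqP; rewrite eqEsubset andbC; apply/andP.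
  have sKc : K \subset <[c]> / 'F(G).
    apply: subset_trans (pcore_sub_Hall hallcF).
    by apply: pcore_max; rewrite ?Fitting_quotient_pgroup // Fitting_normal.
  split=> //; apply: subset_trans (cent_sub_Fitting (quotient_sol _ solG)).
  rewrite subsetI quotientS //= centsC (subset_trans sKc) //.
  by rewrite -[_ \subset _]/(abelian _) quotient_abelian ?cycle_abelian.
have cycK : cyclic K by rewrite defK quotient_cyclic ?cycle_cyclic.
have cardK : #|K| = (p * q)%N.
  by rewrite defK -(card_isog (quotient_isog nFc tiFc)) -orderE.
have hallK : r^'.-Hall(Q) K by rewrite defK.
have nadjQ (s : nat) (z w : coset_of 'F(G)) : prime s -> s != r ->
    z \in Q -> w \in Q -> #[z] = r -> #[w] = s -> ~ commute z w.
  move=> pr_s neq_sr Qz Qw oz ow czw; case/negP: (iso_r s pr_s).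
  apply: (prime_adj_quotient pr_r pr_s (Fitting_normal G)).
  by apply: prime_adj_commute ow czw; rewrite // eq_sym.
(* An element outside the normal Hall [r']-subgroup [K] has order divisible by [r], so a non-trivial
   fixed point would give an edge at [r]. *)
have fpfK : quo_acts_fpf Q K.
  move=> g /setDP[Qg Kg]; apply/eqP; apply: contraT => ntC.
  pose s := pdiv #|'C_K[g]|.
  have pr_s : prime s by rewrite pdiv_prime // cardG_gt1.
  have [w /setIP[Kw cgw] ow] := Cauchy pr_s (pdiv_dvd #|'C_K[g]|).
  have neq_sr : s != r.
    apply: (pnatPpi (pHall_pgroup hallK)).
    by rewrite mem_primes pr_s cardG_gt0 -ow order_dvdG.
  have r_g : r %| #[g].
    apply: contraR Kg => r'g; rewrite (mem_normal_Hall hallK nsKQ Qg).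
    by rewrite /p_elt p'natE.
  have [z gz oz] := cycle_Cauchy pr_r r_g.
  case: (nadjQ s z w) => //.
  - by apply: subsetP gz; rewrite cycle_subG.
  - exact: (subsetP sKQ).
  by case/cycleP: gz => m ->; apply/commute_sym/commuteX/cent1P.
split=> //.
- by rewrite Fitting2_quotient.
- exact: Fitting2_fpf.
have isoQK : Q / K \isog G / Fitting2 G.
  have sF2 : 'F(G) \subset Fitting2 G by apply: sub_cosetpre.
  have := third_isog sF2 (Fitting_normal G) Fitting2_normal.
  by rewrite Fitting2_quotient.
have rQK : r.-group (Q / K).
  rewrite /pgroup card_quotient ?normal_norm //.
  by have [_ _] := and3P hallK; rewrite pnatNK.
have [k Kk ok] : exists2 k, k \in K & #[k] = p.
  by have [|k Kk ok] := @Cauchy _ p K pr_p; [rewrite cardK dvdn_mulr | exists k].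
have cycQK : cyclic (Q / K).
  have nsk : <[k]> <| Q.
    by apply: char_normal_trans nsKQ; rewrite sub_cyclic_char // cycle_subG.
  have prk : prime #|<[k]>| by rewrite -orderE ok.
  have := quotient_cent_prime_cyclic (normal_norm nsk) prk.
  suff -> : 'C_Q(<[k]>) = K by [].
  apply/eqP; rewrite eqEsubset; apply/andP; split.
    apply/subsetP=> g /setIP[Qg ckg]; apply: contraT => Kg.
    have : k \in 'C_K[g].
      by rewrite inE Kk -cent_cycle -cycle_subG centsC cycle_subG.
    rewrite fpfK; last by rewrite inE Kg.
    move/set1gP=> k1.
    by have := prime_neq1 pr_p ok; rewrite k1 eqxx.
  by rewrite subsetI sKQ centsC cycle_subG (subsetP (cyclic_abelian cycK)).
have rF2 : r.-group (G / Fitting2 G) by rewrite /pgroup -(card_isog isoQK).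
have [trF2 | ntF2] := eqVneq (G / Fitting2 G) 1; [by left | right].
split; last by rewrite Fitting2_quotient.
exists (logn r #|G / Fitting2 G|).
  have [_ r_F2 _] := pgroup_pdiv rF2 ntF2.
  by rewrite logn_gt0 mem_primes pr_r cardG_gt0.
by split; [rewrite -(isog_cyclic isoQK) | apply: card_pgroup].
Qed.

End FittingPgroup.

(** * The classification *)

Lemma edge_root_closed_cases (gT : finGroupType) (G : {group gT}) :
    solvable G -> edge_root_closed G -> prime_graph_disconnected G ->
  [\/ case_1 G, case_2 G | case_3 G].
Proof.
move=> solG ecG disG.
have ntF : 'F(G) != 1.
  rewrite trivg_Fitting //; case: disG => -[a Ga] _.
  by apply: contraTneq Ga => ->; rewrite cards1.
pose r := pdiv #|'F(G)|.
have pr_r : prime r by rewrite pdiv_prime // cardG_gt1.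
have r_F : r %| #|'F(G)| by apply: pdiv_dvd.
have Gr : r \in primes #|G|.
  by rewrite mem_primes pr_r cardG_gt0 (dvdn_trans r_F) ?cardSg ?Fitting_sub.
case: (boolP (r.-group 'F(G))) => [rF | ]; last first.
  rewrite /pgroup /pnat cardG_gt0 /= => /allPn[q]; rewrite mem_primes inE.
  case/and3P=> pr_q _ q_F neq_qr; have neq_rq : r != q by rewrite eq_sym.
  have [] := fitting_edge solG ecG disG pr_r pr_q neq_rq r_F q_F.
    by constructor 2.
  by constructor 3.
(* Applied to the single vertex [r], this yields a second prime, so [G] is not an [r]-group. *)
have [|s Gs [neq_sr _ _ _]] := disconnected_edge disG Gr Gr; first by rewrite eqxx.
have [|u [x [pr_u neq_ur Gx ox xP]]] := normal_prime_elt solG ecG pr_r rF ntF.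
  by apply: contra neq_sr => /pnatPpi/(_ Gs).
have Gu : u \in primes #|G| by rewrite mem_primes pr_u cardG_gt0 -ox order_dvdG.
case: (boolP (has [pred t | (t != r) && (t != u)] (primes #|G|))); last first.
  move/hasPn=> only_u; constructor 1.
  have defV : primes #|G| =i [:: r; u].
    move=> t; rewrite !inE; apply/idP/orP=> [Gt | [/eqP-> | /eqP->] //].
    by apply/orP; have := only_u t Gt; rewrite /= negb_and !negbK.
  apply: (Fitting_pgroup_single solG ecG pr_r rF ntF pr_u neq_ur defV).
  apply/negP=> adj_ru; have [|t] := disconnected_edge disG Gr Gu.
    by rewrite adj_ru orbT.
  by rewrite defV !inE => /orP[]/eqP-> []; rewrite eqxx.
case/hasP=> t Gt /= /andP[neq_tr neq_tu]; constructor 2.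
have prG v : v \in primes #|G| -> prime v /\ v %| #|G|.
  by rewrite mem_primes => /and3P[].
have [pr_t t_G] := prG t Gt.
have [y [Gy oy cxy]] := xP t pr_t t_G neq_tr neq_tu.
have neq_ut : u != t by rewrite eq_sym.
(* A prime [v] other than [u] and [r] is the order of some [z] commuting with [x]; by [edge_cent],
   [z] lies in [<[y]>], so [v = t]. *)
have defV : primes #|G| =i [:: u; t; r].
  move=> v; rewrite !inE; apply/idP/or3P=> [Gv | [] /eqP-> //].
  have [-> | neq_vu] := eqVneq v u; first by constructor 1.
  have [-> | neq_vr] := eqVneq v r; first by constructor 3.
  have [pr_v v_G] := prG v Gv.
  have [z [Gz oz cxz]] := xP v pr_v v_G neq_vr neq_vu.
  have /order_dvdG : z \in <[y]>.
    apply: (edge_cent ecG pr_u pr_t neq_ut Gx Gy ox oy cxy Gz cxz).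
    exact: prime_eltC oz.
  by rewrite -orderE oz oy dvdn_prime2 // => ->; constructor 2.
have [|v Gv [neq_vu neq_vt nvu nvt]] := disconnected_edge disG Gu Gt.
  by rewrite (prime_adj_commute pr_u pr_t neq_ut Gx Gy ox oy cxy) orbT.
have def_v : v = r.
  by move: Gv; rewrite defV !inE (negPf neq_vu) (negPf neq_vt) => /eqP.
rewrite def_v in nvu nvt.
exact: (Fitting_pgroup_edge solG ecG pr_r rF ntF pr_u pr_t neq_ut neq_ur neq_tr
          defV Gx Gy ox oy cxy).
Qed.

(** * The converse *)

Section Converse.

Variables (gT : finGroupType) (G : {group gT}) (V : seq nat).
Variable E : seq (nat * nat).
Hypothesis graphG : prime_graph_is G V E.

Lemma prime_graph_uniq : uniq V.
Proof. by case: graphG => /perm_uniq <- _; apply: primes_uniq. Qed.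

Lemma prime_graph_prime p : p \in V -> prime p.
Proof.
by case: graphG => /perm_mem <- _; rewrite mem_primes => /and3P[].
Qed.

Lemma prime_graph_edge p q : prime p -> prime q -> prime_adj G p q ->
  ((p, q) \in E) || ((q, p) \in E).
Proof.
case: graphG => /perm_mem defV defE pr_p pr_q adj_pq.
have /andP[Gp Gq] := prime_adj_primes pr_p pr_q adj_pq.
by rewrite -defE -?defV.
Qed.

End Converse.

Lemma logn_edge_mul p q m : prime p -> prime q -> p != q -> p^'.-nat m ->
  logn p (p * q * m) = 1%N.
Proof.
move=> pr_p pr_q neq_pq p'm.
have m_gt0 : 0 < m by case/andP: p'm.
rewrite !(lognM, muln_gt0, prime_gt0 pr_p, prime_gt0 pr_q) // (logn_prime _ pr_p) eqxx.
rewrite (logn_prime _ pr_q) (negPf neq_pq).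
by rewrite logn_coprime // prime_coprime // -p'natE.
Qed.

(** In each case the edges of the prime graph are pairwise disjoint and their primes divide [#|G|]
    exactly once. *)
Lemma cases_edge_root_closed (gT : finGroupType) (G : {group gT}) :
  [\/ case_1 G, case_2 G | case_3 G] -> edge_root_closed G.
Proof.
case=> [[[a [b graphG]] _] | [p [q [r [graphG caseG]]]] |
        [p [q [r [s [graphG _ _ [K [H [defG [_ oK] [_ oH] _]]]]]]]]];
  apply: edge_root_closed_isolated_edges.
- by move=> p q pr_p pr_q /(prime_graph_edge graphG pr_p pr_q).
- have prV t : t \in [:: p; q; r] -> prime t := @prime_graph_prime _ _ _ _ graphG t.
  have pr_p : prime p by apply: prV; rewrite !inE eqxx.
  have pr_q : prime q by apply: prV; rewrite !inE eqxx orbT.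
  have pr_r : prime r by apply: prV; rewrite !inE eqxx !orbT.
  have := prime_graph_uniq graphG; rewrite /= !inE negb_or !andbT.
  case/andP=> /andP[neq_pq neq_pr] neq_qr.
  have neq_qp : q != p by rewrite eq_sym.
  (* In [case_2b], [#|G|] is the product of the orders of ['F(G)], [Fitting2 G / 'F(G)] and
     [G / Fitting2 G], the first and last being powers of [r]. *)
  have [m cardG r_m] : exists2 m, #|G| = (p * q * m)%N & r.-nat m.
    case: caseG => [[n [_ [K [H [defG [_ oK] [_ oH] _]]] _ _]] | [rF [_ oF2] _ F2G]].
      exists (r ^ n)%N; first by rewrite -(sdprod_card defG) oK oH.
      by rewrite pnatX pnat_id.
    have sF2 : 'F(G) \subset Fitting2 G by apply: sub_cosetpre.
    exists (#|'F(G)| * #|G / Fitting2 G|)%N.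
      have := card_quotient (normal_norm (Fitting2_normal G)) => ->.
      rewrite mulnA -oF2 card_quotient; last first.
        exact: subset_trans (normal_sub (Fitting2_normal G)) (gFnorm _ _).
      by rewrite [(#|_ : _| * _)%N]mulnC !Lagrange ?(normal_sub (Fitting2_normal G)).
    rewrite pnatM; apply/andP; split; first exact: rF.
    case: F2G => [-> | [[n _ [_ ->]] _]].
      by rewrite cards1.
    by rewrite pnatX pnat_id.
  have p'm t : prime t -> t != r -> t^'.-nat m.
    move=> pr_t neq_tr; apply: sub_in_pnat r_m => v _ /eqP->.
    by rewrite !inE eq_sym.
  have edgeE t u : prime t -> prime u -> prime_adj G t u ->
      (t = p /\ u = q) \/ (t = q /\ u = p).
    move=> pr_t pr_u /(prime_graph_edge graphG pr_t pr_u).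
    by rewrite !inE !xpair_eqE => /orP[]/andP[/eqP-> /eqP->]; [left | right].
  move=> t u pr_t pr_u adj_tu; split.
    rewrite cardG; have [[-> _]|[-> _]] := edgeE t u pr_t pr_u adj_tu.
      exact: logn_edge_mul (p'm p pr_p neq_pr).
    by rewrite [(p * q)%N]mulnC; apply: logn_edge_mul (p'm q pr_q neq_qr).
  move=> v pr_v adj_tv.
  have [[tp ->]|[tq ->]] := edgeE t u pr_t pr_u adj_tu;
    have [[tp' ->]|[tq' ->]] := edgeE t v pr_t pr_v adj_tv => //.
    by rewrite -tp -tq'.
  by rewrite -tq -tp'.
have prV t : t \in [:: p; q; r; s] -> prime t := @prime_graph_prime _ _ _ _ graphG t.
have pr_p : prime p by apply: prV; rewrite !inE eqxx.
have pr_q : prime q by apply: prV; rewrite !inE eqxx orbT.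
have pr_r : prime r by apply: prV; rewrite !inE eqxx !orbT.
have pr_s : prime s by apply: prV; rewrite !inE eqxx !orbT.
have := prime_graph_uniq graphG; rewrite /= !inE !negb_or !andbT.
case/and3P=> /and3P[npq npr nps] /andP[nqr nqs] nrs.
have prime_part t u v : prime t -> prime u -> prime v -> t != u -> t != v ->
    t^'.-nat (u * v)%N.
  by move=> pr_t pr_u pr_v ntu ntv; rewrite p'natE // Euclid_dvdM //
    !dvdn_prime2 // negb_or ntu.
have cardG : #|G| = (p * q * (r * s))%N by rewrite -(sdprod_card defG) oK oH mulnC.
have cardG' : #|G| = (r * s * (p * q))%N by rewrite -(sdprod_card defG) oK oH.
have neqs : (p == q = false) * (p == r = false) * (p == s = false) *
    (q == r = false) * (q == s = false) * (r == s = false) *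
    (q == p = false) * (r == p = false) * (s == p = false) *
    (r == q = false) * (s == q = false) * (s == r = false).
  by do ![split]; apply/negbTE; rewrite // eq_sym.
have edgeE t u : prime t -> prime u -> prime_adj G t u ->
    [|| (t == p) && (u == q), (t == q) && (u == p),
        (t == r) && (u == s) | (t == s) && (u == r)].
  move=> pr_t pr_u /(prime_graph_edge graphG pr_t pr_u).
  rewrite !inE !xpair_eqE => /orP[] /orP[] /andP[/eqP-> /eqP->];
    by rewrite !eqxx ?orbT.
move=> t u pr_t pr_u adj_tu; split.
  have /or4P[] := edgeE t u pr_t pr_u adj_tu; case/andP=> /eqP-> _.
  - by rewrite cardG logn_edge_mul // prime_part.
  - by rewrite cardG [(p * q)%N]mulnC logn_edge_mul ?prime_part // eq_sym.
  - by rewrite cardG' logn_edge_mul ?prime_part // eq_sym.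
  by rewrite cardG' [(r * s)%N]mulnC logn_edge_mul ?prime_part // eq_sym.
move=> v pr_v adj_tv; have := edgeE t v pr_t pr_v adj_tv.
have /or4P[] := edgeE t u pr_t pr_u adj_tu; case/andP=> /eqP-> /eqP->;
  by rewrite !neqs eqxx /= ?orbF => /eqP.
Qed.

Theorem lemma5p3 (gT : finGroupType) (G : {group gT}) :
  (solvable G -> power_cograph G -> prime_graph_disconnected G ->
     [\/ case_1 G, case_2 G | case_3 G])
  /\ ([\/ case_1 G, case_2 G | case_3 G] -> power_cograph G).
Proof.
split=> [solG /power_cographP ecG | /cases_edge_root_closed ecG].
  exact: edge_root_closed_cases.
exact/power_cographP.
Qed.
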